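(* Suppose that the filters are $\gamma_i^{(t)}=g(t,\lambda_i)$ with a regulariser $g$ satisfying Assumption (R), that the singular values satisfy Assumption (S), that $\rho>\max(\nu_+,1+\frac{\nu_+}{2})$, and that $|\kappa-D\delta^2|\le C_\kappa\sqrt D\,\delta^2$ with $C_\kappa\in[0,C_\circ)$ (Assumptions (R), (S) and all constants as in the context). Then for all $\mu\in\mathbb{R}^D$ with $t_{\mathfrak w}(\mu)\le t_{\mathfrak s}(\mu)$ we have $$\mathbb{E}\big[\|\widehat\mu^{(\tau)}-\mu\|^2\big]\le C_{\tau,\mathfrak s}\,\mathbb{E}\big[\|\widehat\mu^{(t_{\mathfrak s})}-\mu\|^2\big].$$ For all $\mu\in\mathbb{R}^D$ with $t_{\mathfrak w}(\mu)\ge t_{\mathfrak s}(\mu)$ we obtain $$\mathbb{E}\big[\|\widehat\mu^{(\tau)}-\mu\|^2\big]\le C_{\tau,\mathfrak w}\,(t_{\mathfrak w}\wedge\lambda_D^{-1})^2\,\mathbb{E}\big[\|\widehat\mu^{(t_{\mathfrak w})}-\mu\|_{\mathsf A}^2\big].$$ The constants $C_{\tau,\mathfrak s}$ and $C_{\tau,\mathfrak w}$ depend only on $\rho,\beta_-,\beta_+,L,\nu_-,\nu_+,C_\circ,C_\kappa$.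
   Context: Fix $D\in\mathbb{N}$, a noise level $\delta>0$, numbers $1\ge\lambda_1\ge\dots\ge\lambda_D>0$ and a signal $\mu\in\mathbb{R}^D$. One observes $Y_i=\lambda_i\mu_i+\delta\varepsilon_i$, $i=1,\dots,D$, with $\varepsilon_i$ independent standard normal. For filters $\gamma_i^{(t)}\in[0,1]$, $t\ge0$, set $\widehat\mu_i^{(t)}=\gamma_i^{(t)}\lambda_i^{-1}Y_i$. Norms: $\|v\|^2=\sum_iv_i^2$, $\|v\|_{\mathsf A}^2=\sum_i\lambda_i^2v_i^2$. Notation (all sums over $i=1,\dots,D$): $R_t^2=\sum_i(1-\gamma_i^{(t)})^2Y_i^2$; $B_t^2(\mu)=\sum_i(1-\gamma_i^{(t)})^2\mu_i^2$; $V_t=\delta^2\sum_i(\gamma_i^{(t)})^2\lambda_i^{-2}$; $B_{t,\lambda}^2(\mu)=\sum_i(1-\gamma_i^{(t)})^2\lambda_i^2\mu_i^2$; $V_{t,\lambda}=\delta^2\sum_i(\gamma_i^{(t)})^2$. Indices: $t_\circ=\inf\{t\ge0:V_{t,\lambda}=C_\circ D^{1/2}\delta^2\}$ for some constant $C_\circ\ge1$ (well defined for $C_\circ<D^{1/2}$); for a threshold $\kappa>0$, $\tau=\inf\{t\ge t_\circ:R_t^2\le\kappa\}$; $t_{\mathfrak w}=t_{\mathfrak w}(\mu)=\inf\{t\ge t_\circ:B_{t,\lambda}^2(\mu)\le V_{t,\lambda}\}$; $t_{\mathfrak s}=t_{\mathfrak s}(\mu)=\inf\{t\ge t_\circ:B_t^2(\mu)\le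 V_t\}$. Assumption (R) on $g:\mathbb{R}_+\times\mathbb{R}_+\to[0,1]$: (R1) $g(t,\lambda)$ is nondecreasing in $t$ and $\lambda$, continuous in $t$ with $g(0,\lambda)=0$ and $\lim_{t\to\infty}g(t,\lambda)=1$ for any fixed $\lambda>0$; (R2) for all $t\ge t'\ge t_\circ$ the function $\lambda\mapsto\frac{1-g(t',\lambda)}{1-g(t,\lambda)}$ is nondecreasing; (R3) there exist positive constants $\rho,\beta_-,\beta_+$ such that for all $t\ge t_\circ$ and $\lambda\in(0,1]$: $\beta_-\min((t\lambda)^\rho,1)\le g(t,\lambda)\le\min(\beta_+(t\lambda)^\rho,1)$. Assumption (S): there exist constants $\nu_-,\nu_+>0$ and $L\in\mathbb{N}$ such that for all $L\le k\le D$: $0<L^{-1/\nu_-}\le\lambda_k/\lambda_{\lceil k/L\rceil}$ and $\lambda_k/\lambda_{\lfloor k/L\rfloor}\le L^{-1/\nu_+}<1$. $a\wedge b=\min(a,b)$.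
   Formalization: Assumption (S) is taken to include L ≤ D; for D < L it would put no condition on the singular values and the claim fails, e.g. D=4, L=5, C_∘=1, C_κ=0, λ=(1,1,1,e), g=1-exp(-(tλ)^ρ), μ=(0,0,0,e^{-1/2}δ), e→0. *)

(* Defs.v *)
From HB Require Import structures.
From mathcomp Require Import all_boot all_order all_algebra.
From mathcomp Require Import all_classical all_reals all_analysis.

Set Implicit Arguments.
Unset Strict Implicit.
Unset Printing Implicit Defensive.

Import Order.TTheory GRing.Theory Num.Theory.
Import numFieldNormedType.Exports.

Local Open Scope classical_set_scope.
Local Open Scope ring_scope.

Section Probability.
Context {d : measure_display} {T : measurableType d} {R : realType}.
Variable P : probability T R.

Definition standard_normal (X : {RV P >-> R}) : Prop :=
  forall A : set R, measurable A -> distribution P X A = normal_prob 0 1 A.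

Definition mutually_independent (I : finType) (X : I -> {RV P >-> R}) : Prop :=
  forall (J : {set I}) (A : I -> set R),
    (forall i, i \in J -> measurable (A i)) ->
    P (\bigcap_(i in [set` J]) (X i @^-1` A i)) =
    (\prod_(i in J) P (X i @^-1` A i))%E.

End Probability.

Section Indexing.
Context {R : realType} {D : nat}.

(* The k-th coordinate of v, counted from 1: since 'I_D counts from 0, this is
   v at the ordinal k - 1. It is only used for 1 <= k <= D. *)
Definition entry (v : 'I_D -> R) (k : nat) : R :=
  if insub k.-1 is Some i then v i else 0.

Definition sqnorm (v : 'I_D -> R) : R := \sum_i v i ^+ 2.

Definition sqnormA (lam v : 'I_D -> R) : R := \sum_i lam i ^+ 2 * v i ^+ 2.

End Indexing.

Definition ceil_divn (k L : nat) : nat := (k + L.-1) %/ L.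

Section Filters.
Context {R : realType} {D : nat}.
Implicit Types (gam : R -> 'I_D -> R) (lam mu Y : 'I_D -> R).

Definition observation (delta : R) lam mu {T : Type} (eps : 'I_D -> T -> R)
    (w : T) : 'I_D -> R :=
  fun i => lam i * mu i + delta * eps i w.

Definition estimator gam lam Y (t : R) : 'I_D -> R :=
  fun i => gam t i * (lam i)^-1 * Y i.

Definition residual2 gam Y (t : R) : R :=
  \sum_i (1 - gam t i) ^+ 2 * Y i ^+ 2.

Definition sbias2 gam mu (t : R) : R :=
  \sum_i (1 - gam t i) ^+ 2 * mu i ^+ 2.

Definition svar (delta : R) gam lam (t : R) : R :=
  delta ^+ 2 * \sum_i gam t i ^+ 2 * lam i ^- 2.

Definition wbias2 gam lam mu (t : R) : R :=
  \sum_i (1 - gam t i) ^+ 2 * lam i ^+ 2 * mu i ^+ 2.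

Definition wvar (delta : R) gam (t : R) : R :=
  delta ^+ 2 * \sum_i gam t i ^+ 2.

Definition t_circ (Co delta : R) gam : R :=
  inf [set t | 0 <= t /\
               wvar delta gam t = Co * Num.sqrt D%:R * delta ^+ 2].

Definition tau (Co delta kappa : R) gam Y : R :=
  inf [set t | t_circ Co delta gam <= t /\ residual2 gam Y t <= kappa].

Definition t_weak (Co delta : R) gam lam mu : R :=
  inf [set t | t_circ Co delta gam <= t /\
               wbias2 gam lam mu t <= wvar delta gam t].

Definition t_strong (Co delta : R) gam lam mu : R :=
  inf [set t | t_circ Co delta gam <= t /\
               sbias2 gam mu t <= svar delta gam lam t].

End Filters.

Section Assumptions.
Context {R : realType}.

(* The regulariser g lives on [0, +oo[ x [0, +oo[; its values at negative
   arguments are unconstrained. *)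
Definition assumption_R1 (g : R -> R -> R) : Prop :=
  [/\ (forall t lam, 0 <= t -> 0 <= lam -> 0 <= g t lam <= 1),
      (forall t t' lam, 0 <= lam -> 0 <= t' -> t' <= t ->
         g t' lam <= g t lam),
      (forall t lam lam', 0 <= t -> 0 <= lam -> lam <= lam' ->
         g t lam <= g t lam') &
      (forall lam, 0 < lam ->
         [/\ {within `[0, +oo[, continuous (fun t => g t lam)},
             g 0 lam = 0 &
             g t lam @[t --> +oo] --> (1 : R)])].

(* The quotient is only compared where its denominator is nonzero. Filters such
   as Landweber's have g t lam = 1 for some lam, and there the convention
   x / 0 = 0 would make the condition fail for an irrelevant reason. *)
Definition assumption_R2 (t0 : R) (g : R -> R -> R) : Prop :=
  forall t t', t0 <= t' -> t' <= t ->
  forall lam lam', 0 <= lam -> lam <= lam' ->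
    1 - g t lam != 0 -> 1 - g t lam' != 0 ->
    (1 - g t' lam) / (1 - g t lam) <= (1 - g t' lam') / (1 - g t lam').

Definition assumption_R3 (rho bm bp t0 : R) (g : R -> R -> R) : Prop :=
  forall t lam, t0 <= t -> 0 < lam <= 1 ->
    bm * Num.min ((t * lam) `^ rho) 1 <= g t lam
      <= Num.min (bp * (t * lam) `^ rho) 1.

Definition assumption_R (rho bm bp t0 : R) (g : R -> R -> R) : Prop :=
  [/\ assumption_R1 g, assumption_R2 t0 g & assumption_R3 rho bm bp t0 g].

(* L <= D keeps the condition from being vacuous: for D < L it would not
   constrain the singular values at all. *)
Definition assumption_S (nu_m nu_p : R) (L D : nat) (lam : 'I_D -> R) : Prop :=
  (L <= D)%N /\
  forall k : nat, (L <= k <= D)%N ->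
    [/\ 0 < L%:R `^ (- nu_m^-1),
        L%:R `^ (- nu_m^-1) <= entry lam k / entry lam (ceil_divn k L),
        entry lam k / entry lam (k %/ L) <= L%:R `^ (- nu_p^-1) &
        L%:R `^ (- nu_p^-1) < 1].

End Assumptions.

(* Main.v *)
(* Write v(t), n(t), W(t) for the sums of gam^2, gam, gam^2 lam^-2. If K is the
   first index with t lam_K < 1, then (R) and (S) make v(t) and n(t) comparable to
   K and W(t) comparable to K lam_K^-2, hence to min(t, lam_D^-1)^2 v(t); moreover
   W grows at most polynomially in v.

   Let s >= t_circ be a time at which the weak bias is at most the weak variance,
   i.e. s >= t_w. The risk at tau is at most a constant times the strong bias plus
   the strong variance at s, and the theorem takes s = max(t_w, t_s):
   - if tau < s, then R_tau^2 <= kappa bounds the weak bias at tau by the weak bias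
     at s, the weak stochastic error at s and (kappa - R_s^2)_+, whose mean is of
     the order of the weak variance. The strong bias at tau exceeds a multiple of
     the one at s by at most min(s, lam_D^-1)^2 times the weak bias at tau, which
     the comparison of W and v turns into the strong variance at s;
   - if tau > s, consider times t_j with v(t_j) = 2^j v(s). The event tau > t_j
     forces R_{t_j}^2 > kappa, a deviation of order 2^j of a Gaussian quadratic
     form, with probability exponentially small in 2^j, which beats the polynomial
     growth of W(t_j).
   All probabilistic estimates reduce to the exponential moment of
   \sum_i (a_i (x_i^2 - 1) + b_i x_i) for independent standard normal x_i. *)

Require Import Defs.
From mathcomp Require Import all_boot all_order all_algebra.
From mathcomp Require Import all_classical all_reals all_analysis.
From mathcomp Require Import measurable_realfun zify ring lra.

Set Implicit Arguments.
Unset Strict Implicit.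
Unset Printing Implicit Defensive.

Import Order.TTheory GRing.Theory Num.Theory.
Import numFieldNormedType.Exports.

Local Open Scope classical_set_scope.
Local Open Scope ring_scope.

(** * Exponential moments of Gaussian quadratic forms *)

Section WeightedIntegral.
Local Open Scope ereal_scope.
Import HBNNSimple.

Lemma integral_weighted_nnsfun (R : realType) (d : measure_display)
    (T : measurableType d) (mu : {measure set T -> \bar R}) (X G : T -> R)
    (h : {nnsfun R >-> R}) :
  measurable_fun setT X -> measurable_fun setT G -> (forall w, (0 <= G w)%R) ->
  \int[mu]_w (h (X w) * G w)%:E =
  \sum_(r \in range h)
    r%:E * \int[mu]_w (\1_(h @^-1` [set r]) (X w) * G w)%:E.
Proof.
move=> mX mG G0.
have mi r : measurable_fun setT
    (fun w => (\1_(h @^-1` [set r]) (X w) * G w)%:E).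
  apply/measurable_EFinP; apply: measurable_funM => //.
  by apply: (measurableT_comp _ mX); exact: measurable_indic.
transitivity (\int[mu]_w (\sum_(r \in range h)
    (r%:E * (\1_(h @^-1` [set r]) (X w) * G w)%:E))).
  apply: eq_integral => w _; rewrite {1}fimfunE EFinM -fsumEFin//.
  rewrite ge0_mule_fsuml.
    by apply: eq_fsbigr => r _; rewrite -!EFinM mulrA.
  by move=> r; rewrite nnfun_muleindic_ge0.
rewrite ge0_integral_fsum//.
- apply: eq_fsbigr => r /set_mem[y _ hy]; rewrite ge0_integralZl//.
  + by move=> w _; rewrite lee_fin mulr_ge0.
  + by rewrite lee_fin -hy.
- by move=> r; apply: measurable_funeM.
- move=> r w _; rewrite -EFinM mulrA EFinM mule_ge0 ?lee_fin//.
  by rewrite -lee_fin nnfun_muleindic_ge0.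
Qed.

(** Agreement on indicators passes to simple functions by linearity and to nonnegative functions by
    monotone convergence. The weights [G] and [G'] let one statement serve both for replacing a
    factor of a product by its mean and for passing from [P] to Lebesgue measure with a density. *)
Lemma integral_weighted_ext (R : realType) (d d' : measure_display)
    (T : measurableType d) (T' : measurableType d')
    (mu : {measure set T -> \bar R}) (mu' : {measure set T' -> \bar R})
    (X G : T -> R) (X' G' : T' -> R) (f : R -> R) :
  measurable_fun setT X -> measurable_fun setT X' ->
  measurable_fun setT G -> measurable_fun setT G' ->
  (forall w, (0 <= G w)%R) -> (forall w, (0 <= G' w)%R) ->
  (forall A, measurable A ->
     \int[mu]_w (\1_A (X w) * G w)%:E = \int[mu']_w (\1_A (X' w) * G' w)%:E) ->
  measurable_fun setT f -> (forall x, (0 <= f x)%R) ->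
  \int[mu]_w (f (X w) * G w)%:E = \int[mu']_w (f (X' w) * G' w)%:E.
Proof.
move=> mX mX' mG mG' G0 G0' HA mf f0.
have mfE : measurable_fun setT (EFin \o f) by exact/measurable_EFinP.
pose h := nnsfun_approx measurableT mfE.
have lim (d0 : measure_display) (T0 : measurableType d0)
    (m0 : {measure set T0 -> \bar R}) (X0 G1 : T0 -> R) :
    measurable_fun setT X0 -> measurable_fun setT G1 ->
    (forall w, (0 <= G1 w)%R) ->
    \int[m0]_w (f (X0 w) * G1 w)%:E =
    limn (fun n => \int[m0]_w (h n (X0 w) * G1 w)%:E).
  move=> mX0 mG0 G00; rewrite -monotone_convergence//.
  - apply: eq_integral => w _; apply/esym/cvg_lim => //.
    rewrite EFinM; under eq_fun do rewrite EFinM.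
    apply: cvgeZr => //.
    exact: (cvg_nnsfun_approx measurableT mfE (fun x _ => f0 x)).
  - move=> n; apply/measurable_EFinP; apply: measurable_funM => //.
    exact: measurableT_comp.
  - by move=> n w _; rewrite lee_fin mulr_ge0.
  - move=> w _ m n mn; rewrite lee_fin; apply: ler_wpM2r => //.
    exact/lefP/nd_nnsfun_approx.
rewrite !lim//; congr (limn _); apply/funext => n.
rewrite !integral_weighted_nnsfun//; apply: eq_fsbigr => r _.
by rewrite HA//; exact: measurable_funPTI.
Qed.

End WeightedIntegral.

(** * Expectation of a product of independent variables *)

Section Independence.
Context {R : realType} {d : measure_display} {T : measurableType d}.
Variable P : probability T R.
Local Open Scope ereal_scope.

Lemma prod_indicE (I : finType) (A : I -> set T) w :
  (\prod_i \1_(A i) w)%R = \1_(\bigcap_(i in [set` [set: I]%SET]) A i) w :> R.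
Proof.
rewrite [RHS]indicE; case: (boolP (w \in _)) => [/set_mem Aw|].
  rewrite big1// => i _; rewrite indicE.
  by have -> : w \in A i by apply/mem_set/Aw; exact: finset.in_setT.
rewrite notin_setE => Aw.
have [i nAi] : exists i, ~ A i w.
  by apply/existsNP => Ai; apply: Aw => i _; exact: Ai.
by rewrite (bigD1 i)//= indicE (memNset nAi) mul0r.
Qed.

(** Induction on the size of [J], outside of which every [f i] is an indicator. For empty [J] this
    is the definition of independence. Otherwise, for some [k] in [J], both sides are integrals of
    [f k] against a weight, and it suffices to compare them for indicators in place of [f k], where
    the induction hypothesis for [J] without [k] applies. *)
Let integral_prod_except (I : finType) (X : I -> {RV P >-> R}) (J : {set I})
    (f : I -> R -> R) :
  mutually_independent X ->
  (forall i, measurable_fun setT (f i)) -> (forall i x, (0 <= f i x)%R) ->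
  (forall i, \int[P]_w (f i (X i w))%:E < +oo) ->
  (forall i, i \notin J ->
     exists2 A : set R, measurable A & f i = (\1_A : R -> R)) ->
  \int[P]_w (\prod_i f i (X i w))%:E = \prod_i \int[P]_w (f i (X i w))%:E.
Proof.
move=> indX; move: {2}#|J| (leqnn #|J|) => n.
elim: n J f => [|n IHn] J f.
  rewrite leqn0 cards_eq0 => /eqP -> mf f0 fF find.
  have /choice[A HA] : forall i, exists B : set R,
      measurable B /\ f i = (\1_B : R -> R).
    move=> i; have [|B mB fB] := find i; first by rewrite inE.
    by exists B.
  have mXA i : measurable (X i @^-1` A i) by apply: measurable_funPTI; case: (HA i).
  have := indX [set: I]%SET A (fun i _ => (HA i).1).
  rewrite (eq_bigl xpredT) => [indA|i]; last exact: finset.in_setT.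
  have -> : \prod_i \int[P]_w (f i (X i w))%:E = \prod_i P (X i @^-1` A i).
    apply: eq_bigr => i _; rewrite -[X in P X]setIT -integral_indic//.
    by apply: eq_integral => w _; rewrite (HA i).2 !indicE.
  rewrite -indA -[X in P X]setIT -integral_indic//; last first.
    by apply: fin_bigcap_measurable => // i _; exact: mXA.
  apply: eq_integral => w _; congr EFin; rewrite -prod_indicE.
  by apply: eq_bigr => i _; rewrite (HA i).2 !indicE.
move=> Jn mf f0 fF find.
have [J0|[k kJ]] := set_0Vmem J.
  by apply: (IHn J) => //; rewrite J0 cards0.
(* The other expectations are finite, so their product is a real number and can act as the constant
   weight [cst c]. *)
pose c := fine (\prod_(j | j != k) \int[P]_w (f j (X j w))%:E).
have int_ge0 j : 0 <= \int[P]_w (f j (X j w))%:E.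
  by apply: integral_ge0 => w _; rewrite lee_fin.
have cE : c%:E = \prod_(j | j != k) \int[P]_w (f j (X j w))%:E.
  by rewrite fineK//; apply: prode_fin_num => j _; rewrite ge0_fin_numE.
have c0 : (0 <= c)%R by rewrite -lee_fin cE; exact: prode_ge0.
have mfX j : measurable_fun setT (fun w => f j (X j w)).
  by apply: measurableT_comp => //; exact: mf.
pose G w := (\prod_(j | j != k) f j (X j w))%R.
have mG : measurable_fun setT G.
  rewrite /G; under eq_fun do rewrite big_mkcond.
  apply: (@measurable_prod _ _ _ _ I _ (fun j w =>
    if j != k then f j (X j w) else 1%R)) => j _.
  by case: (j != k).
transitivity (\int[P]_w (f k (X k w) * G w)%:E).
  by apply: eq_integral => w _; rewrite (bigD1 k).
transitivity (\int[P]_w (f k (X k w) * c)%:E).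
  apply: (@integral_weighted_ext R d d T T P P (X k) G (X k) (cst c)) => //.
  - by move=> w; apply: prodr_ge0.
  move=> A mA.
  pose f' j := if j == k then (\1_A : R -> R) else f j.
  have f'G w : (\prod_j f' j (X j w) = \1_A (X k w) * G w)%R.
    rewrite (bigD1 k)//= /f' eqxx; congr (_ * _)%R.
    by apply: eq_bigr => j /negbTE ->.
  have indA_le1 : \int[P]_w (\1_A (X k w))%:E <= 1.
    have -> : \int[P]_w (\1_A (X k w))%:E = P (X k @^-1` A).
      rewrite -[X in P X]setIT -integral_indic//; exact: measurable_funPTI.
    by apply: probability_le1; exact: measurable_funPTI.
  under eq_integral do rewrite -f'G.
  rewrite (IHn (J :\ k)%SET).
  - rewrite (bigD1 k)//= [f' k]/f' eqxx.
    rewrite (eq_bigr (fun j => \int[P]_w (f j (X j w))%:E)); last first.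
      by move=> j /negbTE jk; rewrite /f' jk.
    rewrite -cE -ge0_integralZr//.
    apply/measurable_EFinP.
    exact: (measurableT_comp (measurable_indic mA) (measurable_funPT (X k))).
  - by move: Jn; rewrite (cardsD1 k J) kJ add1n ltnS.
  - by move=> j; rewrite /f'; case: (j == k) => //; exact: measurable_indic.
  - by move=> j x; rewrite /f'; case: (j == k).
  - move=> j; rewrite /f'; case: eqP => [->|//].
    exact: le_lt_trans indA_le1 (ltry _).
  - move=> j; rewrite !inE negb_and negbK /f' => /orP[->|jJ]; first by exists A.
    case: eqP => _; first by exists A.
    exact: find.
rewrite (bigD1 k)//= -cE -ge0_integralZr//.
- exact/measurable_EFinP.
- by move=> w _; rewrite lee_fin.
Qed.

Lemma integral_prod_independent (I : finType) (X : I -> {RV P >-> R})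
    (f : I -> R -> R) :
  mutually_independent X ->
  (forall i, measurable_fun setT (f i)) -> (forall i x, (0 <= f i x)%R) ->
  (forall i, \int[P]_w (f i (X i w))%:E < +oo) ->
  \int[P]_w (\prod_i f i (X i w))%:E = \prod_i \int[P]_w (f i (X i w))%:E.
Proof.
move=> indX mf f0 fF; apply: (@integral_prod_except _ X [set: I]) => // i.
by rewrite inE.
Qed.

End Independence.

(** * Exponential moments of independent standard normal variables *)

Section GaussianExponential.
Context {R : realType} {d : measure_display} {T : measurableType d}.
Variable P : probability T R.

Lemma integral_standard_normal (X : {RV P >-> R}) (f : R -> R) :
  standard_normal X -> measurable_fun setT f -> (forall x, 0 <= f x) ->
  (\int[P]_w (f (X w))%:E =
   \int[lebesgue_measure]_x (f x * normal_pdf 0 1 x)%:E)%E.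
Proof.
move=> nX mf f0.
rewrite -(@integral_weighted_ext R _ _ T _ P lebesgue_measure X (cst 1) id
  (normal_pdf 0 1) f) //.
- by apply: eq_integral => w _; rewrite mulr1.
- exact: measurable_normal_pdf.
- exact: normal_pdf_ge0.
move=> A mA; under eq_integral do rewrite mulr1.
have -> : (\int[P]_w (\1_A (X w))%:E = P (X @^-1` A))%E.
  by rewrite -[X in P X]setIT -integral_indic//; exact: measurable_funPTI.
have := nX A mA; rewrite /distribution /pushforward => ->.
rewrite /normal_prob [LHS]integral_mkcond; apply: eq_integral => x _.
by rewrite patchE indicE /=; case: (x \in A); rewrite ?mul1r ?mul0r.
Qed.

Lemma exp_quadratic_normal_pdf (a b x : R) : a < 1 / 2 ->
  let s := Num.sqrt (1 - 2 * a)^-1 in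
  expR (a * (x ^+ 2 - 1) + b * x) * normal_pdf 0 1 x =
  s * expR (b ^+ 2 * s ^+ 2 / 2 - a) * normal_pdf (b * s ^+ 2) s x.
Proof.
move=> a2 s.
have s2 : s ^+ 2 = (1 - 2 * a)^-1 by rewrite sqr_sqrtr// invr_ge0; lra.
have s0 : 0 < s by rewrite sqrtr_gt0 invr_gt0; lra.
rewrite !normal_pdfE ?oner_neq0 ?gt_eqF//.
have -> : normal_peak 1 = s * normal_peak s.
  rewrite /normal_peak expr1n mul1r -mulrnAr sqrtrM ?sqr_ge0//.
  by rewrite sqrtr_sqr gtr0_norm// invfM mulrA mulfV ?mul1r// gt_eqF.
have hexp : expR (a * (x ^+ 2 - 1) + b * x) * normal_fun 0 1 x =
    expR (b ^+ 2 * s ^+ 2 / 2 - a) * normal_fun (b * s ^+ 2) s x.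
  rewrite /normal_fun -!expRD; congr expR.
  have h : 1 - 2 * a != 0 by apply/eqP => h0; lra.
  by rewrite !s2; field.
transitivity (s * normal_peak s *
    (expR (a * (x ^+ 2 - 1) + b * x) * normal_fun 0 1 x)); first by ring.
by rewrite hexp; ring.
Qed.

Lemma integral_exp_quadratic (X : {RV P >-> R}) (a b : R) :
  standard_normal X -> `|a| <= 1 / 4 ->
  (\int[P]_w (expR (a * ((X w) ^+ 2 - 1) + b * X w))%:E <=
   (expR (4 * a ^+ 2 + b ^+ 2))%:E)%E.
Proof.
move=> nX; rewrite ler_norml => /andP[a1 a2].
have a3 : a < 1 / 2 by lra.
pose s := Num.sqrt (1 - 2 * a)^-1.
have s2 : s ^+ 2 = (1 - 2 * a)^-1 by rewrite sqr_sqrtr// invr_ge0; lra.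
have s0 : 0 < s by rewrite sqrtr_gt0 invr_gt0; lra.
have mq : measurable_fun setT (fun x : R => expR (a * (x ^+ 2 - 1) + b * x)).
  apply: measurableT_comp => //; apply: measurable_funD.
    apply: measurable_funM => //; apply: measurable_funB => //.
  by apply: measurable_funM.
rewrite (@integral_standard_normal X _ nX mq)//.
under eq_integral do rewrite exp_quadratic_normal_pdf// -/s EFinM.
rewrite ge0_integralZl//; last 3 first.
- by apply/measurable_EFinP; exact: measurable_normal_pdf.
- by move=> x _; rewrite lee_fin normal_pdf_ge0.
- by rewrite lee_fin mulr_ge0 ?expR_ge0// ltW.
rewrite integral_normal_pdf mule1 lee_fin.
have u0 : 0 < 1 - 2 * a by lra.
(* From [s ^+ 2 = 1 + 2 a / (1 - 2 a)] and [1 + x <= expR x]; the first-order term [a] then cancels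
   against the centring of the square. *)
have s_exp : s <= expR (a / (1 - 2 * a)).
  rewrite -(@ler_pXn2r _ 2)// ?nnegrE ?expR_ge0 ?(ltW s0)// s2.
  rewrite -expRM_natl; apply: le_trans (expR_ge1Dx _).
  rewrite le_eqVlt; apply/orP; left; apply/eqP; field.
  by rewrite gt_eqF.
apply: (@le_trans _ _ (expR (a / (1 - 2 * a)) * expR (b ^+ 2 * s ^+ 2 / 2 - a))).
  by rewrite ler_wpM2r ?expR_ge0.
rewrite -expRD ler_expR.
have i2 : (1 - 2 * a)^-1 <= 2 by rewrite -[leRHS]invrK lef_pV2 ?posrE//; lra.
have e1 : a / (1 - 2 * a) - a <= 4 * a ^+ 2.
  have -> : a / (1 - 2 * a) - a = 2 * a ^+ 2 * (1 - 2 * a)^-1.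
    by field; rewrite gt_eqF.
  by have := sqr_ge0 a; nra.
have e2 : b ^+ 2 * s ^+ 2 / 2 <= b ^+ 2.
  by rewrite s2; have := sqr_ge0 b; nra.
lra.
Qed.

Lemma expectation_exp_quadratic (I : finType) (X : I -> {RV P >-> R})
    (a b : I -> R) :
  mutually_independent X -> (forall i, standard_normal (X i)) ->
  (forall i, `|a i| <= 1 / 4) ->
  (\int[P]_w (expR (\sum_i (a i * ((X i w) ^+ 2 - 1) + b i * X i w)))%:E <=
   (expR (\sum_i (4 * a i ^+ 2 + b i ^+ 2)))%:E)%E.
Proof.
move=> indX nX a4.
pose f i (x : R) := expR (a i * (x ^+ 2 - 1) + b i * x).
have mf i : measurable_fun setT (f i).
  apply: measurableT_comp => //; apply: measurable_funD.
    apply: measurable_funM => //; apply: measurable_funB => //.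
  by apply: measurable_funM.
have fle i := integral_exp_quadratic (b i) (nX i) (a4 i).
under eq_integral do rewrite expR_sum.
rewrite (@integral_prod_independent _ _ _ _ _ X f)//.
- rewrite expR_sum -prodEFin.
  suff /andP[] : (0 <= \prod_i \int[P]_w (f i (X i w))%:E <=
      \prod_i (expR (4 * a i ^+ 2 + b i ^+ 2))%:E)%E by [].
  apply: (big_ind2 (fun x y : \bar R => 0 <= x <= y)%E) => //.
  - by rewrite lexx lee01.
  - move=> x1 y1 x2 y2 /andP[x10 xy1] /andP[x20 xy2].
    by rewrite mule_ge0//= lee_pmul.
  - move=> i _; rewrite fle andbT; apply: integral_ge0 => w _.
    by rewrite lee_fin expR_ge0.
- by move=> i x; exact: expR_ge0.
- by move=> i; apply: le_lt_trans (fle i) (ltry _).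
Qed.

End GaussianExponential.

(** * Expectation bounds through measurable majorants *)

Section OuterExpectation.
Context {R : realType} {d : measure_display} {T : measurableType d}.
Variable P : probability T R.
Implicit Types (f g : T -> R) (c k : R).

(* The stopping time is not known to be measurable, so expectations involving
   it are bounded through measurable majorants. *)
Definition mean_le f c : Prop :=
  exists F : T -> R, [/\ measurable_fun setT F, forall w, 0 <= F w,
    forall w, f w <= F w & (\int[P]_w (F w)%:E <= c%:E)%E].

Lemma mean_le_trans g c f k :
  mean_le g c -> (forall w, f w <= g w) -> c <= k -> mean_le f k.
Proof.
move=> [F [mF F0 gF cF]] fg ck; exists F; split => //.
  by move=> w; exact: le_trans (fg w) (gF w).
by apply: le_trans cF _; rewrite lee_fin.
Qed.

Lemma integral_probability_cst c : (\int[P]_w c%:E = c%:E)%E.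
Proof.
transitivity (c%:E * P setT)%E; last by rewrite probability_setT mule1.
exact: (integral_cst P measurableT c%:E).
Qed.

Lemma mean_le_cst c : 0 <= c -> mean_le (fun=> c) c.
Proof.
move=> c0; exists (cst c); split => //.
by rewrite integral_probability_cst.
Qed.

Lemma mean_leD f g c k : mean_le f c -> mean_le g k ->
  mean_le (fun w => f w + g w) (c + k).
Proof.
move=> [F [mF F0 fF cF]] [G [mG G0 gG kG]]; exists (fun w => F w + G w); split.
- exact: measurable_funD.
- by move=> w; rewrite addr_ge0.
- by move=> w; exact: lerD.
- under eq_integral do rewrite EFinD.
  rewrite ge0_integralD//; try by [move=> w _; rewrite lee_fin|exact/measurable_EFinP].
  by rewrite EFinD leeD.
Qed.

Lemma mean_leZ f c k : 0 <= k -> mean_le f c ->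
  mean_le (fun w => k * f w) (k * c).
Proof.
move=> k0 [F [mF F0 fF cF]]; exists (fun w => k * F w); split.
- exact: measurable_funM.
- by move=> w; rewrite mulr_ge0.
- by move=> w; exact: ler_wpM2l.
- under eq_integral do rewrite EFinM.
  rewrite ge0_integralZl//; try by [move=> w _; rewrite lee_fin|exact/measurable_EFinP].
  by rewrite EFinM lee_wpmul2l// lee_fin.
Qed.

Lemma mean_le_sum (I : Type) (r : seq I) (p : pred I) (f : I -> T -> R)
    (c : I -> R) : (forall i, p i -> mean_le (f i) (c i)) ->
  mean_le (fun w => \sum_(i <- r | p i) f i w) (\sum_(i <- r | p i) c i).
Proof.
move=> fc; elim: r => [|i r IHr].
  rewrite big_nil; apply: (mean_le_trans (mean_le_cst (lexx 0))) => //.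
  by move=> w; rewrite big_nil.
have [ip|npi] := boolP (p i); last first.
  by apply: (mean_le_trans IHr) => [w|]; rewrite big_cons (negbTE npi).
by apply: (mean_le_trans (mean_leD (fc i ip) IHr)) => [w|];
  rewrite big_cons ip.
Qed.

(** The integral of a nonnegative function is a supremum over the simple functions below it, hence
    monotone even where [f] is not measurable. *)
Lemma mean_leE f c : (forall w, 0 <= f w) -> mean_le f c ->
  ('E_P[f] <= c%:E)%E.
Proof.
move=> f0 [F [mF F0 fF cF]]; rewrite unlock; apply: le_trans cF.
rewrite !ge0_integralTE//; try by move=> w; rewrite lee_fin.
by apply: le_ereal_sup => _ [h /= hf <-]; exists h => // w;
  apply: le_trans (hf w) _; rewrite lee_fin.
Qed.

End OuterExpectation.

Lemma expR_half_le2 (R : realType) : expR (1 / 2) <= 2 :> R.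
Proof.
have := expR_ge1Dx (- (1 / 2) : R); rewrite expRN => h.
rewrite -[leLHS]invrK -[leRHS]invrK lef_pV2 ?posrE ?invr_gt0 ?expR_gt0//.
by apply: le_trans h; lra.
Qed.

(** * Moments of a standard Gaussian vector *)

Section GaussianVector.
Context {R : realType} {d : measure_display} {T : measurableType d}.
Variables (P : probability T R) (I : finType) (X : I -> {RV P >-> R}).
Hypotheses (indX : mutually_independent X) (nX : forall i, standard_normal (X i)).

Let measurable_quadratic (a b : I -> R) : measurable_fun setT
  (fun w => \sum_i (a i * ((X i w) ^+ 2 - 1) + b i * X i w)).
Proof.
apply: measurable_sum => i; apply: measurable_funD.
  apply: measurable_funM => //; apply: measurable_funB => //.
  exact: measurable_funX.
exact: measurable_funM.
Qed.

Lemma mean_le_exp (a b : I -> R) : (forall i, `|a i| <= 1 / 4) ->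
  \sum_i (4 * a i ^+ 2 + b i ^+ 2) <= 1 / 2 ->
  mean_le P (fun w =>
    expR (\sum_i (a i * ((X i w) ^+ 2 - 1) + b i * X i w))) 2.
Proof.
move=> a4 ab; exists (fun w =>
  expR (\sum_i (a i * ((X i w) ^+ 2 - 1) + b i * X i w))); split => //.
  exact: measurableT_comp (measurable_quadratic a b).
apply: le_trans (expectation_exp_quadratic b indX nX a4) _.
by rewrite lee_fin (le_trans _ (expR_half_le2 R))// ler_expR.
Qed.

(** The weight 1/4 is put on coordinate [i] alone; undoing the centring costs [expR (1 / 4) <= 2].
    The bounds on second and fourth moments below follow from [1 + z <= expR z]. *)
Let mean_le_exp_sqr i :
  mean_le P (fun w => expR ((X i w) ^+ 2 / 4)) 4.
Proof.
pose a j : R := if j == i then 1 / 4 else 0.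
have a4 j : `|a j| <= 1 / 4.
  by rewrite /a; case: ifP; rewrite ?normr0 ?ger0_norm; lra.
have ab : \sum_j (4 * a j ^+ 2 + (fun=> 0) j ^+ 2) <= 1 / 2.
  rewrite (bigD1 i)//= big1 => [|j /negbTE ji]; rewrite /a ?eqxx ?ji; lra.
have := mean_leZ (k := 2) _ (mean_le_exp a4 ab).
move=> /(_ ltac:(lra)) h; apply: (mean_le_trans h); last by lra.
move=> w /=; rewrite (bigD1 i)//= big1 => [|j /negbTE ji]; last first.
  by rewrite /a ji !mul0r addr0.
rewrite /a eqxx mul0r !addr0.
apply: (@le_trans _ _ (expR (1 / 2) * expR (1 / 4 * ((X i w) ^+ 2 - 1)))).
  by rewrite -expRD ler_expR; lra.
by rewrite ler_wpM2r ?expR_ge0// expR_half_le2.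
Qed.

Lemma mean_le_sqr i : mean_le P (fun w => (X i w) ^+ 2) 16.
Proof.
have := mean_leZ (k := 4) _ (mean_le_exp_sqr i).
move=> /(_ ltac:(lra)) h; apply: (mean_le_trans h); last by lra.
by move=> w; have := expR_ge1Dx ((X i w) ^+ 2 / 4); lra.
Qed.

Lemma mean_le_fourth i : mean_le P (fun w => (X i w) ^+ 4) 256.
Proof.
have := mean_leZ (k := 64) _ (mean_le_exp_sqr i).
move=> /(_ ltac:(lra)) h; apply: (mean_le_trans h); last by lra.
move=> w; set y := X i w ^+ 2.
have -> : X i w ^+ 4 = y ^+ 2 by rewrite -exprM.
have y0 : 0 <= y by exact: sqr_ge0.
have -> : y / 4 = 2%:R * (y / 8) by lra.
rewrite expRM_natl; have := expR_ge1Dx (y / 8) => h1.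
have : (1 + y / 8) ^+ 2 <= expR (y / 8) ^+ 2.
  by rewrite lerXn2r ?nnegrE ?expR_ge0//; lra.
nra.
Qed.

(* [1 - exp(-t y) <= t y] reduces the second moment of a shifted Gaussian
   vector to its exponential moment. *)
Lemma expectation_ge_sqr (m c : I -> R) :
  ((3^-1 * \sum_i (m i ^+ 2 + c i ^+ 2))%:E <=
   'E_P[fun w => (\sum_i (m i + c i * X i w) ^+ 2)%R])%E.
Proof.
set M := \sum_i _; rewrite unlock.
have M0 : 0 <= M by apply: sumr_ge0 => i _; rewrite addr_ge0 ?sqr_ge0.
have y0 w : 0 <= \sum_i (m i + c i * X i w) ^+ 2.
  by apply: sumr_ge0 => i _; exact: sqr_ge0.
have [M_eq0|Mn0] := eqVneq M 0.
  by rewrite M_eq0 mulr0; apply: integral_ge0 => w _; rewrite lee_fin.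
have Mp : 0 < M by rewrite lt0r Mn0.
(* With [t * M = 1 / 8] the quadratic weights stay within 1/4, and the exponential moment of [- t]
   times the sum is at most [expR (- (1 / 8) + 1 / 16)]. Since [expR (- (1 / 16)) <= 16 / 17], the
   mean is at least [8 * M / 17], which exceeds [M / 3]. *)
pose t := (8 * M)^-1.
have t0 : 0 < t by rewrite invr_gt0; lra.
have tM : t * M = 1 / 8 by rewrite /t; field.
have cM i : c i ^+ 2 <= M.
  rewrite /M (bigD1 i)//= [X in _ <= X + _]addrC -addrA lerDl addr_ge0 ?sqr_ge0//.
  by apply: sumr_ge0 => j _; rewrite addr_ge0 ?sqr_ge0.
pose a i := - t * c i ^+ 2; pose b i := - t * 2 * m i * c i.
have a4 i : `|a i| <= 1 / 4.
  rewrite /a mulNr normrN (ger0_norm (mulr_ge0 (ltW t0) (sqr_ge0 _))).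
  by have : t * c i ^+ 2 <= t * M; [rewrite ler_pM2l|lra].
have my : measurable_fun setT (fun w => \sum_i (m i + c i * X i w) ^+ 2).
  apply: measurable_sum => j; apply: measurable_funX; apply: measurable_funD => //.
  exact: measurable_funM.
have qE w : - t * \sum_i (m i + c i * X i w) ^+ 2 =
    - t * M + \sum_i (a i * ((X i w) ^+ 2 - 1) + b i * X i w).
  by rewrite /M !mulr_sumr -big_split/=; apply: eq_bigr => i _; rewrite /a /b; ring.
have abM : \sum_i (4 * a i ^+ 2 + b i ^+ 2) <= 1 / 16.
  have -> : 1 / 16 = 4 * (t * M) * t * M by rewrite tM -mulrA tM; lra.
  rewrite {2}/M mulr_sumr; apply: ler_sum => i _; rewrite /a /b.
  have -> : 4 * (- t * c i ^+ 2) ^+ 2 + (- t * 2 * m i * c i) ^+ 2 =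
    4 * (t * c i ^+ 2) * t * (m i ^+ 2 + c i ^+ 2) by ring.
  rewrite ler_wpM2r ?addr_ge0 ?sqr_ge0// ler_wpM2r ?(ltW t0)//.
  by rewrite ler_pM2l ?ltr0n// ler_pM2l.
have : (1 <= \int[P]_w (t * \sum_i (m i + c i * X i w) ^+ 2 +
    expR (- t * \sum_i (m i + c i * X i w) ^+ 2))%:E)%E.
  rewrite -[leLHS](integral_probability_cst P); apply: ge0_le_integral => //.
  - apply/measurable_EFinP; apply: measurable_funD; first exact: measurable_funM.
    by apply: measurableT_comp => //; exact: measurable_funM.
  - move=> w _; rewrite lee_fin mulNr.
    by have := expR_ge1Dx (- (t * \sum_i (m i + c i * X i w) ^+ 2)); lra.
under eq_integral do rewrite EFinD.
have mexp : measurable_fun setT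
    (fun w => expR (- t * \sum_i (m i + c i * X i w) ^+ 2)).
  by apply: measurableT_comp => //; exact: measurable_funM.
have mty : measurable_fun setT (fun w => t * \sum_i (m i + c i * X i w) ^+ 2).
  exact: measurable_funM.
have ty0 w : 0 <= t * \sum_i (m i + c i * X i w) ^+ 2.
  exact: mulr_ge0 (ltW t0) (y0 w).
rewrite ge0_integralD//; try by [move=> w _; rewrite lee_fin ?expR_ge0 ?ty0|exact/measurable_EFinP].
under eq_integral do rewrite EFinM.
under [X in (_ + X)%E]eq_integral do rewrite qE expRD EFinM.
rewrite !ge0_integralZl//; try by [move=> w _; rewrite lee_fin ?expR_ge0|
  rewrite lee_fin ?expR_ge0 ?(ltW t0)|exact/measurable_EFinP|
  apply/measurable_EFinP; apply: measurableT_comp].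
have Eexp : (\int[P]_w (expR (\sum_i (a i * ((X i w) ^+ 2 - 1) + b i * X i w)))%:E
    <= (expR (1 / 16))%:E)%E.
  by apply: le_trans (expectation_exp_quadratic b indX nX a4) _; rewrite lee_fin ler_expR.
move=> h; have {Eexp}h : (1 <= t%:E * \int[P]_w (\sum_i (m i + c i * X i w) ^+ 2)%R%:E +
    (expR (- (1 / 16)))%:E)%E.
  apply: le_trans h _; apply: leeD => //.
  apply: le_trans (lee_wpmul2l _ Eexp) _; first by rewrite lee_fin expR_ge0.
  by rewrite -EFinM lee_fin -expRD ler_expR mulNr tM; lra.
have e16 : expR (- (1 / 16)) <= 16 / 17 :> R.
  have e1 : expR (- (1 / 16)) * expR (1 / 16) = 1 :> R.
    by rewrite -expRD addNr expR0.
  by have := expR_ge1Dx (1 / 16 : R); have := expR_gt0 (- (1 / 16) : R); nra.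
case: (\int[P]_w (\sum_i (m i + c i * X i w) ^+ 2)%R%:E)%E h => [y||].
- rewrite -EFinM -EFinD !lee_fin => h.
  have ty : 1 / 17 <= t * y by lra.
  have : 8 * M * (1 / 17) <= 8 * M * (t * y) by rewrite ler_pM2l//; lra.
  have -> : 8 * M * (t * y) = y by rewrite /t; field.
  by lra.
- by rewrite leey.
- by rewrite gt0_muleNy ?lte_fin// addNye leeNy_eq.
Qed.

End GaussianVector.

(** * Decay of the singular values and effective dimension *)

Section Sequences.
Context {R : realType}.
Implicit Types (f a : nat -> R) (D L K : nat).

Lemma sum_nat_divn f L K n : (0 < L)%N -> (K <= n)%N ->
  \sum_(L * K <= k < L * n) f (k %/ L)%N = L%:R * \sum_(K <= j < n) f j.
Proof.
move=> L0; elim: n => [|n IHn] Kn.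
  by move: Kn; rewrite leqn0 => /eqP ->; rewrite !big_geq ?mulr0.
move: Kn; rewrite leq_eqVlt => /orP[/eqP ->|Kn].
  by rewrite !big_geq ?mulr0.
rewrite ltnS in Kn.
rewrite (@big_cat_nat _ _ _ (L * n))//= ?leq_mul//.
rewrite IHn// big_nat_recr//= mulrDr; congr (_ + _).
rewrite (eq_big_nat _ _ (F2 := fun=> f n)); last first.
  move=> k; rewrite mulnS => /andP[k1 k2]; congr f.
  have -> : k = (n * L + (k - L * n))%N by rewrite mulnC subnKC.
  rewrite divnMDl// divn_small ?addn0//.
  by rewrite ltn_subLR// addnC.
by rewrite sumr_const_nat mulnS addnK mulr_natl.
Qed.

(* Regrouping the indices by [k %/ L] compares the tail beyond [L * K] with
   [L * r] times the whole tail, which is then absorbed. *)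
Lemma tail_sum_le f D L K (r : R) : (0 < L)%N -> L%:R * r < 1 -> 0 <= r ->
  (forall k, 0 <= f k) ->
  (forall j k, (0 < j <= k)%N -> (k <= D)%N -> f k <= f j) ->
  (forall k, (L <= k <= D)%N -> f k <= r * f (k %/ L)%N) ->
  (0 < K <= D)%N ->
  \sum_(K <= k < D.+1) f k <= L%:R / (1 - L%:R * r) * (K%:R * f K).
Proof.
move=> L0 Lr r0 f0 fdec fr /andP[K0 KD].
set S := \sum_(K <= k < D.+1) f k.
have S0 : 0 <= S by apply: sumr_ge0.
suff : S <= L%:R * (K%:R * f K) + L%:R * r * S.
  move=> h; have u0 : 0 < 1 - L%:R * r by lra.
  by rewrite mulrAC ler_pdivlMr//; lra.
have SE : S = \sum_(K <= k < D.+1 | (k < L * K)%N) f k +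
    \sum_(K <= k < D.+1 | ~~ (k < L * K)%N) f k.
  by rewrite /S (bigID (fun k => (k < L * K)%N)).
rewrite [leLHS]SE; apply: lerD.
  rewrite big_nat_cond.
  apply: (@le_trans _ _ (\sum_(K <= k < D.+1 | (k < L * K)%N) f K)).
    rewrite [leRHS]big_nat_cond; apply: ler_sum => k /andP[/andP[Kk kD] _].
    by apply: fdec => //; rewrite K0.
  apply: (@le_trans _ _ (\sum_(0 <= k < L * K) f K)).
    have [h|h] := leqP D.+1 (L * K).
      apply: (@le_trans _ _ (\sum_(0 <= k < D.+1) f K)).
        rewrite (@big_cat_nat _ _ _ K 0 D.+1)//=; last exact: leqW.
        rewrite big_mkcond ler_wpDl ?sumr_ge0//.
        by apply: ler_sum => k _; case: ifP.
      by rewrite (@big_cat_nat _ _ _ D.+1 0 (L * K))//= lerDl sumr_ge0.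
    rewrite (@big_cat_nat _ _ _ (L * K) K D.+1)//=; last 2 first.
    - by rewrite leq_pmull.
    - exact: ltnW.
    rewrite [X in _ + X]big_nat_cond [X in _ + X]big1 ?addr0; last first.
      by move=> k /andP[/andP[k1 _]]; rewrite ltnNge k1.
    rewrite (@big_cat_nat _ _ _ K 0 (L * K))//= ?leq_pmull//.
    rewrite big_mkcond ler_wpDl ?sumr_ge0//.
    by apply: ler_sum => k _; case: ifP.
  by rewrite sumr_const_nat subn0 -[leLHS]mulr_natl natrM mulrA.
have -> : L%:R * r * S = r * \sum_(L * K <= k < L * D.+1) f (k %/ L)%N.
  by rewrite sum_nat_divn 1?leqW// /S; ring.
rewrite mulr_sumr.
have LKD : (L * K <= L * D.+1)%N by rewrite leq_mul// leqW.
have DLD : (D.+1 <= L * D.+1)%N by rewrite leq_pmull.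
have [h|h] := leqP D.+1 (L * K).
  rewrite big_nat_cond big1 ?sumr_ge0// => [k _|k /andP[/andP[_ k1] k2]].
    exact: mulr_ge0.
  by rewrite (leq_trans k1 h) in k2.
rewrite (@big_cat_nat _ _ _ (L * K) K D.+1)//=; last 2 first.
- by rewrite leq_pmull.
- exact: ltnW.
rewrite big_nat_cond big1 ?add0r; last first.
  by move=> k /andP[/andP[_ k1]]; rewrite k1.
rewrite (@big_cat_nat _ _ _ D.+1 (L * K) (L * D.+1))//=; last exact: ltnW.
rewrite ler_wpDr ?sumr_ge0// => [k _|]; first exact: mulr_ge0.
rewrite big_mkcond; apply: ler_sum_nat => k /andP[k1 k2].
rewrite ltnNge k1 /=; apply: fr.
by rewrite (leq_trans _ k1) ?leq_pmulr.
Qed.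

(** Strong induction on [k]. Passing from [k] to its rounded-up quotient by [L] costs a factor [c].
    If that quotient falls to [j] or below, one step is enough; otherwise the index shrinks by at
    least the factor 2/3, and [c <= (3 / 2) ^+ Q] is paid for by the decrease of [(k / j) ^+ Q]. *)
Lemma polynomial_decay a D L Q (c : R) : (1 < L <= D)%N ->
  1 <= c -> c <= (3 / 2) ^+ Q ->
  (forall k, (0 < k <= D)%N -> 0 < a k) ->
  (forall j k, (0 < j <= k)%N -> (k <= D)%N -> a k <= a j) ->
  (forall k, (L <= k <= D)%N -> a (ceil_divn k L) <= c * a k) ->
  forall j k, (0 < j <= k)%N -> (k <= D)%N ->
  a j <= c * (k%:R / j%:R) ^+ Q * a k.
Proof.
move=> /andP[L1 LD] c1 cQ a0 adec ca j k; elim/ltn_ind: k => k IHk /andP[j0 jk] kD.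
have k0 : (0 < k)%N := leq_trans j0 jk.
have jR : 0 < j%:R :> R by rewrite ltr0n.
have ak0 : 0 < a k by rewrite a0// k0.
have kj1 : 1 <= (k%:R / j%:R) ^+ Q :> R.
  by rewrite exprn_ege1// ler_pdivlMr// mul1r ler_nat.
suff [h|//] : a j <= c * a k \/ a j <= c * (k%:R / j%:R) ^+ Q * a k.
  by apply: le_trans h _; rewrite ler_wpM2r ?(ltW ak0)// ler_peMr//; lra.
have [kL|Lk] := ltnP k L.
  left; have := ca L; rewrite leqnn LD => /(_ isT).
  have -> : ceil_divn L L = 1%N.
    rewrite /ceil_divn divnDl// divnn (ltnW L1) divn_small ?addn0//.
    by rewrite prednK// (ltnW L1).
  move=> h; apply: le_trans (adec 1%N j _ (leq_trans jk kD)) _; first by rewrite j0.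
  by apply: le_trans h _; rewrite ler_wpM2l ?adec ?k0//; [lra|exact: ltnW].
have := ca k; rewrite Lk kD => /(_ isT) hc.
have L0 : (0 < L)%N by exact: ltnW.
have ceil_gt0 : (0 < ceil_divn k L)%N.
  by rewrite /ceil_divn divn_gt0// (leq_trans Lk)// leq_addr.
have [kLj|Ljk] := leqP k (L * j).
  left; apply: le_trans hc; apply: adec; last exact: leq_trans jk kD.
  rewrite ceil_gt0 /= /ceil_divn -ltnS ltn_divLR// mulSn mulnC.
  by move: kLj L0; lia.
right.
have jceil : (j <= ceil_divn k L)%N.
  by rewrite /ceil_divn leq_divRL// mulnC; move: Ljk; lia.
(* The extremal case is [L = 2], [k = 3], whose rounded-up quotient is 2. *)
have k3 : (ceil_divn k L * 3 <= 2 * k)%N.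
  have h1 : (ceil_divn k L * L <= k + L.-1)%N by exact: leq_trunc_div.
  have h2 : (L < k)%N by apply: leq_ltn_trans Ljk; rewrite leq_pmulr.
  move: h1 h2 L1; case: (L) => // l /=; case: l => // l.
  by nia.
have ck : (ceil_divn k L < k)%N by lia.
have := IHk _ ck; rewrite j0 jceil => /(_ isT (leq_trans (ltnW ck) kD)) h.
apply: le_trans h _; set k' := ceil_divn k L in hc ceil_gt0 jceil k3 ck *.
rewrite -!mulrA ler_wpM2l ?(le_trans ler01)//.
apply: (@le_trans _ _ ((k'%:R / j%:R) ^+ Q * (c * a k))).
  by rewrite ler_wpM2l// exprn_ge0// divr_ge0// ltW.
rewrite mulrA ler_wpM2r ?(ltW ak0)//.
apply: (@le_trans _ _ ((k'%:R / j%:R) ^+ Q * (3 / 2) ^+ Q)).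
  by rewrite ler_wpM2l// exprn_ge0// divr_ge0// ltW.
rewrite -exprMn lerXn2r ?nnegrE ?mulr_ge0 ?invr_ge0 ?ler0n//.
rewrite mulrAC ler_wpM2r ?invr_ge0 ?ler0n//.
have : (k' * 3)%:R <= (2 * k)%:R :> R by rewrite ler_nat.
by rewrite !natrM; lra.
Qed.

End Sequences.

(** * Consequences of Assumption (S) for the singular values *)

Section Spectrum.
Context {R : realType} {D : nat}.
Variable lam : 'I_D -> R.

Lemma entryS (i : 'I_D) : entry lam i.+1 = lam i.
Proof. by rewrite /entry /= valK. Qed.

Lemma entryP (k : nat) : (0 < k <= D)%N -> exists2 i : 'I_D, k = i.+1 & entry lam k = lam i.
Proof.
move=> /andP[k0 kD]; have kD' : (k.-1 < D)%N by rewrite prednK.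
exists (Ordinal kD'); first by rewrite /= prednK.
by rewrite -entryS /= prednK.
Qed.

Lemma sum_entry (F : R -> R) :
  \sum_i F (lam i) = \sum_(1 <= k < D.+1) F (entry lam k).
Proof.
by rewrite big_add1 big_mkord; apply: eq_bigr => i _; rewrite entryS.
Qed.

Hypothesis lam01 : forall i, 0 < lam i <= 1.
Hypothesis lam_dec : forall i j : 'I_D, (i <= j)%N -> lam j <= lam i.

Lemma entry_gt0 k : (0 < k <= D)%N -> 0 < entry lam k.
Proof. by move=> /entryP[i _ ->]; case/andP: (lam01 i). Qed.

Lemma entry_ge0 k : 0 <= entry lam k.
Proof.
by rewrite /entry; case: insubP => // i _ _; case/andP: (lam01 i) => /ltW.
Qed.

Lemma entry_le1 k : (0 < k <= D)%N -> entry lam k <= 1.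
Proof. by move=> /entryP[i _ ->]; case/andP: (lam01 i). Qed.

Lemma entry_dec j k : (0 < j <= k)%N -> (k <= D)%N -> entry lam k <= entry lam j.
Proof.
move=> /andP[j0 jk] kD.
have [|i ki ->] := @entryP k; first by rewrite kD (leq_trans j0).
have [|i' ji' ->] := @entryP j; first by rewrite j0 (leq_trans jk).
by apply: lam_dec; rewrite -ltnS -ki -ji'.
Qed.

Lemma entryD_le i : entry lam D <= lam i.
Proof. by rewrite -entryS entry_dec/=. Qed.

End Spectrum.

(** For [L = 1] the strict inequality of (S), read at [k = L], would say [1 < 1]. *)
Lemma assumption_S_gt1 (R : realType) (nu_m nu_p : R) (L D : nat) (lam : 'I_D -> R) :
  (0 < L)%N -> assumption_S nu_m nu_p L lam -> (1 < L <= D)%N.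
Proof.
move=> L0 [LD /(_ L)]; rewrite leqnn LD => /(_ isT)[_ _ _].
rewrite andbT; case: L L0 LD => // -[|//] _ _.
by rewrite powR1 ltxx.
Qed.

(** The upper ratio bound of (S) makes the [p]-th powers decay by [r = L ^ (- p / nu_p)] when the
    index grows by the factor [L]. For [p > nu_p] this beats the number [L] of indices per block, so
    a tail is comparable with its first term times its first index, uniformly in [D]. *)
Lemma tail_powR (R : realType) (nu_m nu_p p : R) (L : nat) :
  (0 < L)%N -> 0 < nu_p -> nu_p < p ->
  exists2 C : R, 0 < C & forall D (lam : 'I_D -> R),
    (forall i, 0 < lam i <= 1) ->
    (forall i j : 'I_D, (i <= j)%N -> lam j <= lam i) ->
    assumption_S nu_m nu_p L lam ->
    forall t K, 0 <= t -> (0 < K <= D)%N ->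
    \sum_(K <= k < D.+1) (t * entry lam k) `^ p <=
      C * (K%:R * (t * entry lam K) `^ p).
Proof.
move=> L0 nu0 nup; have p0 : 0 < p by exact: lt_trans nup.
have nuN : nu_p != 0 by rewrite gt_eqF.
pose r : R := L%:R `^ (- nu_p^-1 * p).
have LR0 : 0 < L%:R :> R by rewrite ltr0n.
have r0 : 0 <= r by exact: powR_ge0.
have Lr : L%:R * r <= 1.
  rewrite -[X in X * _]powRr1 ?(ltW LR0)// -powRD; last by rewrite (gt_eqF LR0) implybT.
  rewrite -[leRHS](powRr0 L%:R) ler_powR ?ler1n//.
  by rewrite mulNr subr_le0 -(mulVf nuN) ler_pM2l ?invr_gt0 ?ltW.
(* The constant is chosen before any spectrum is given, when [L = 1] is not yet excluded; there
   [L%:R * r = 1], the quotient is 0 by convention, and the summand 1 keeps the constant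
   positive. *)
exists (1 + L%:R / (1 - L%:R * r)).
  by rewrite ltr_wpDr// divr_ge0 ?ler0n// subr_ge0.
move=> D lam lam01 lam_dec HS t K t0 KD.
have /andP[L1 LD] := assumption_S_gt1 L0 HS.
have Lr1 : L%:R * r < 1.
  rewrite -[X in X * _]powRr1 ?(ltW LR0)// -powRD; last by rewrite (gt_eqF LR0) implybT.
  have -> : 1 + - nu_p^-1 * p = - nu_p^-1 * (p - nu_p) by field.
  have [_ /(_ L)] := HS; rewrite leqnn LD => /(_ isT)[_ _ _ hlt].
  rewrite powRrM -[ltRHS](_ : 1 `^ (p - nu_p) = 1); last by rewrite powR1.
  by apply: gt0_ltr_powR; rewrite ?nnegrE ?powR_ge0// subr_gt0.
have ta0 k : 0 <= t * entry lam k by rewrite mulr_ge0// entry_ge0.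
apply: (@le_trans _ _ (L%:R / (1 - L%:R * r) * (K%:R * (t * entry lam K) `^ p))).
  apply: (@tail_sum_le _ (fun k => (t * entry lam k) `^ p)) => //.
  - by move=> k; exact: powR_ge0.
  - move=> j k jk kD; apply: ge0_ler_powR; rewrite ?nnegrE ?(ltW p0)//.
    by rewrite ler_wpM2l// entry_dec.
  - move=> k kL; have [_ HSk] := HS; have [_ _ hk _] := HSk k kL.
    have kL0 : (0 < k %/ L <= D)%N.
      case/andP: kL => k1 k2; rewrite divn_gt0// k1/=.
      exact: leq_trans (leq_div _ _) k2.
    rewrite /r powRrM -powRM ?powR_ge0//.
    apply: ge0_ler_powR; rewrite ?nnegrE ?(ltW p0) ?ta0
      ?(mulr_ge0 (powR_ge0 _ _) (ta0 _))//.
    rewrite mulrCA ler_wpM2l//.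
    by rewrite -ler_pdivrMr// entry_gt0.
rewrite mulrDl mul1r lerDr mulr_ge0 ?powR_ge0 ?ler0n//.
Qed.

Lemma exprn_unbounded (R : realType) (c : R) : exists Q : nat, c <= (3 / 2) ^+ Q.
Proof.
pose n := (Num.truncn (2 * c)).+1; exists n.
have hn : 2 * c <= n%:R by exact: ltW (Num.Theory.truncnS_gt _).
suff : 1 + n%:R / 2 <= (3 / 2 : R) ^+ n by lra.
elim: n {hn} => [|n IHn]; first by rewrite expr0 mul0r addr0.
by rewrite exprS -natr1; have := ler0n R n; nra.
Qed.

(** By the lower ratio bound of (S), one division of the index by [L] costs at most
    [L ^ (1 / nu_m)]. Iterating it gives polynomial decay with an exponent independent of [D]. *)
Lemma spectrum_decay (R : realType) (nu_m nu_p : R) (L : nat) : (0 < L)%N -> 0 < nu_m ->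
  exists c (Q : nat), 1 <= c :> R /\ forall D (lam : 'I_D -> R),
    (forall i, 0 < lam i <= 1) ->
    (forall i j : 'I_D, (i <= j)%N -> lam j <= lam i) ->
    assumption_S nu_m nu_p L lam ->
    forall j k, (0 < j <= k)%N -> (k <= D)%N ->
    entry lam j <= c * (k%:R / j%:R) ^+ Q * entry lam k.
Proof.
move=> L0 nu0; pose c : R := L%:R `^ (nu_m^-1).
have c1 : 1 <= c.
  by rewrite -[leLHS](powRr0 L%:R) ler_powR ?ler1n// invr_ge0 ltW.
have [Q cQ] := exprn_unbounded c; exists c, Q; split=> //.
move=> D lam lam01 lam_dec HS; have LD := assumption_S_gt1 L0 HS.
apply: (@polynomial_decay _ _ D L) => //.
- by move=> k; exact: entry_gt0.
- by move=> j k; exact: entry_dec.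
move=> k kL; have [_ HSk] := HS; have [_ hk _ _] := HSk k kL.
have k0 : (0 < ceil_divn k L <= D)%N.
  case/andP: kL => k1 k2; case/andP: LD => L1 _.
  rewrite /ceil_divn divn_gt0// (leq_trans k1) ?leq_addr//=.
  rewrite -ltnS ltn_divLR//; nia.
have ac0 := entry_gt0 lam01 k0.
move: hk; rewrite ler_pdivlMr// powRN => hk.
have c0 : 0 < c by exact: lt_le_trans c1.
by move: hk; rewrite -/c mulrC ler_pdivrMr// mulrC.
Qed.

Lemma ler_sum_nat_sub (R : realType) (F : nat -> R) (m n p q : nat) :
  (m <= n <= p)%N -> (p <= q)%N ->
  (forall k, (m <= k < q)%N -> 0 <= F k) ->
  \sum_(n <= k < p) F k <= \sum_(m <= k < q) F k.
Proof.
move=> /andP[mn np] pq F0.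
rewrite (@big_cat_nat _ _ _ n m q)//=; last exact: leq_trans np pq.
rewrite (@big_cat_nat _ _ _ p n q)//= addrCA lerDl addr_ge0// big_nat_cond;
  apply: sumr_ge0 => k /andP[/andP[k1 k2] _]; apply: F0.
- by rewrite k1 (leq_trans k2)// (leq_trans np pq).
- by rewrite (leq_trans _ k1)// (leq_trans mn np).
Qed.

(* [K] is the first index with [t * entry lam K < 1], or [D] if there is none. *)
Lemma effective_dimension (R : realType) (rho bm bp nu_m nu_p : R) (L : nat) :
  0 < rho -> 0 < bm -> 0 < bp -> (0 < L)%N -> 0 < nu_m -> 0 < nu_p ->
  Num.max nu_p (1 + nu_p / 2) < rho ->
  exists C : R, 1 <= C /\ forall D (lam : 'I_D -> R),
    (0 < D)%N -> (forall i, 0 < lam i <= 1) ->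
    (forall i j : 'I_D, (i <= j)%N -> lam j <= lam i) ->
    assumption_S nu_m nu_p L lam ->
    forall (t : R) (G : R -> R), 0 < t ->
    (forall x, 0 < x <= 1 ->
      bm * Num.min ((t * x) `^ rho) 1 <= G x <= Num.min (bp * (t * x) `^ rho) 1) ->
    1 <= \sum_i G (lam i) ^+ 2 ->
    exists2 K : nat, (0 < K <= D)%N &
      [/\ \sum_i G (lam i) <= C * K%:R,
          K%:R <= C * \sum_i G (lam i) ^+ 2,
          \sum_i G (lam i) ^+ 2 * lam i ^- 2 <= C * (K%:R * entry lam K ^- 2),
          K%:R * entry lam K ^- 2 <= C * \sum_i G (lam i) ^+ 2 * lam i ^- 2 &
          Num.min t (entry lam D)^-1 <= (entry lam K)^-1
            <= C * Num.min t (entry lam D)^-1].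
Proof.
move=> rho0 bm0 bp0 L0 num0 nup0; rewrite gt_max => /andP[rho1 rho2].
have rho2' : nu_p < 2 * rho - 2 by lra.
have [Ca Ca0 HCa] := tail_powR nu_m L0 nup0 rho1.
have [Cb Cb0 HCb] := tail_powR nu_m L0 nup0 rho2'.
have [c [Q [c1 Hc]]] := spectrum_decay nu_p L0 num0.
have c0 : 0 < c by exact: lt_le_trans c1.
(* [C2] bounds the ratio of two singular values whose indices differ by at most a factor 2. *)
pose C2 := c * 2 ^+ Q.
have C21 : 1 <= C2 by rewrite /C2 mulr_ege1// exprn_ege1// ler1n.
have C20 : 0 < C2 by exact: lt_le_trans C21.
(* [cb] solves [bp * Ca * u ^ rho = 1]. The number [e] will bound [u K] from below: by [C2^-1] for
   [K > 1], because the preceding index has [u] at least 1, and by [cb] for [K = 1]. *)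
pose cb := (bp * Ca)^-1 `^ rho^-1.
have cb0 : 0 < cb by rewrite powR_gt0// invr_gt0 mulr_gt0.
pose e := Num.min C2^-1 cb.
have e0 : 0 < e by rewrite lt_min invr_gt0 C20.
have e1 : e <= 1 by rewrite ge_min invf_le1// C21.
have eC2 : e <= C2^-1 by rewrite ge_min lexx.
have ecb : e <= cb by rewrite ge_min lexx orbT.
pose b := bm * e `^ rho.
have b0 : 0 < b by rewrite mulr_gt0// powR_gt0.
have k1 : 0 <= bp * Ca by rewrite mulr_ge0 ?ltW.
have k2 : 0 <= b ^- 2 by rewrite invr_ge0 sqr_ge0.
have k3 : 0 <= bp ^+ 2 * Cb by rewrite mulr_ge0 ?sqr_ge0 ?ltW.
have k4 : 0 <= 2 * C2 ^+ 2 * b ^- 2 by rewrite mulr_ge0// mulr_ge0// sqr_ge0.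
have k5 : 0 <= e^-1 by rewrite invr_ge0 ltW.
exists (1 + bp * Ca + b ^- 2 + bp ^+ 2 * Cb + 2 * C2 ^+ 2 * b ^- 2 + e^-1).
set C := _ + e^-1.
split; first by rewrite /C; lra.
move=> D lam D0 lam01 lam_dec HS t G t0 HG v1.
pose a := entry lam; pose u k := t * a k.
have a0 k : (0 < k <= D)%N -> 0 < a k by exact: entry_gt0.
have a01 k : (0 < k <= D)%N -> 0 < a k <= 1.
  by move=> kD; rewrite a0// /a entry_le1.
have adec j k : (0 < j <= k)%N -> (k <= D)%N -> a k <= a j by exact: entry_dec.
have u0 k : (0 < k <= D)%N -> 0 < u k by move=> kD; rewrite mulr_gt0// a0.
have udec j k : (0 < j <= k)%N -> (k <= D)%N -> u k <= u j.
  by move=> jk kD; rewrite /u ler_pM2l// adec.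
have G0 k : (0 < k <= D)%N -> 0 <= G (a k).
  move=> kD; have /andP[h _] := HG _ (a01 _ kD); apply: le_trans h.
  by rewrite mulr_ge0 ?(ltW bm0)// le_min powR_ge0 ler01.
have G1 k : (0 < k <= D)%N -> G (a k) <= 1.
  by move=> kD; have /andP[_] := HG _ (a01 _ kD); rewrite le_min => /andP[].
have Gu k : (0 < k <= D)%N -> G (a k) <= bp * u k `^ rho.
  by move=> kD; have /andP[_] := HG _ (a01 _ kD); rewrite le_min => /andP[].
pose pK k := (0 < k)%N && ((D <= k)%N || (u k < 1)).
have exK : exists k, pK k by exists D; rewrite /pK D0 leqnn.
case: (ex_minnP exK) => K /andP[K0 hK] Kmin {exK}.
have KD : (K <= D)%N by apply: Kmin; rewrite /pK D0 leqnn.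
have ult k : (0 < k < K)%N -> 1 <= u k.
  move=> /andP[k0 kK]; rewrite leNgt; apply/negP => uk1.
  by move: kK; rewrite ltnNge Kmin// /pK k0 uk1 orbT.
have K0D : (0 < K <= D)%N by rewrite K0.
exists K; first by [].
have KR0 : 0 <= K%:R :> R by rewrite ler0n.
have KR1 : 1 <= K%:R :> R by rewrite ler1n.
have inKD k : (K <= k < D.+1)%N -> (0 < k <= D)%N.
  by move=> /andP[kK kD]; rewrite (leq_trans K0 kK).
(* The terms before [K] are at most 1; from [K] on, the tail bound with exponent [rho] applies, and
   [u K < 1]. *)
have n1_le : \sum_i G (lam i) <= (1 + bp * Ca) * K%:R.
  rewrite (sum_entry lam).
  have [DK|KltD] := leqP D K.
    apply: (@le_trans _ _ (\sum_(1 <= k < D.+1) 1)).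
      by apply: ler_sum_nat => k kD; exact: G1.
    have -> : K = D by apply/eqP; rewrite eqn_leq KD.
    rewrite sumr_const_nat subn1/= mulrDl mul1r lerDl.
    by rewrite mulr_ge0 ?ler0n.
  rewrite leqNgt KltD/= in hK.
  rewrite (@big_cat_nat _ _ _ K)//=; last exact: leqW.
  rewrite mulrDl mul1r; apply: lerD.
    apply: (@le_trans _ _ (\sum_(1 <= k < K) 1)).
      apply: ler_sum_nat => k /andP[k1' k2']; apply: G1.
      by rewrite k1' (leq_trans (ltnW k2')).
    by rewrite sumr_const_nat ler_nat leq_subr.
  apply: (@le_trans _ _ (\sum_(K <= k < D.+1) bp * u k `^ rho)).
    by apply: ler_sum_nat => k kD; apply: Gu; exact: inKD.
  rewrite -mulr_sumr -mulrA ler_pM2l//.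
  apply: le_trans (HCa D lam lam01 lam_dec HS t K (ltW t0) K0D) _.
  rewrite ler_pM2l// ler_piMr// -[leRHS](_ : 1 `^ rho = 1); last by rewrite powR1.
  apply: ge0_ler_powR; rewrite ?nnegrE ?(ltW rho0)//; first exact: ltW (u0 _ K0D).
  exact: ltW.
have v_le_n1 : \sum_i G (lam i) ^+ 2 <= \sum_i G (lam i).
  apply: ler_sum => i _; have iD : (0 < i.+1 <= D)%N := ltn_ord i.
  by rewrite -entryS expr2 ler_piMl ?G0 ?G1.
have uK_ge : e <= u K.
  have [K1|K1] := leqP K 1.
    have KE : K = 1%N by apply/eqP; rewrite eqn_leq K1.
    apply: le_trans ecb _.
    (* For [K = 1] the whole sum is a tail, and the hypothesis that the sum of squares is at least 1
       forces [u K] not to be small. *)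
    have : 1 <= bp * Ca * u K `^ rho.
      apply: le_trans v1 (le_trans v_le_n1 _); rewrite (sum_entry lam).
      apply: (@le_trans _ _ (\sum_(1 <= k < D.+1) bp * u k `^ rho)).
        by apply: ler_sum_nat => k kD; exact: Gu.
      rewrite -mulr_sumr -mulrA ler_pM2l//.
      have := HCa D lam lam01 lam_dec HS t 1%N (ltW t0) D0.
      by rewrite mul1r KE.
    rewrite mulrC -ler_pdivrMr ?mulr_gt0// div1r => h.
    have -> : u K = (u K `^ rho) `^ rho^-1.
      by rewrite -powRrM divff ?gt_eqF// powRr1// ltW// u0.
    apply: ge0_ler_powR; rewrite ?nnegrE ?invr_ge0 ?powR_ge0 ?(ltW rho0)//.
  apply: le_trans eC2 _; rewrite -div1r ler_pdivrMr//.
  have K'0 : (0 < K.-1)%N by rewrite -ltnS prednK.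
  have K'K : (K.-1 < K)%N by rewrite prednK.
  apply: le_trans (ult K.-1 _) _; first by rewrite K'0.
  have := Hc D lam lam01 lam_dec HS K.-1 K; rewrite K'0 (ltnW K'K) => /(_ isT KD) h.
  rewrite /u -mulrA ler_pM2l//; apply: le_trans h _.
  rewrite mulrC ler_pM2l ?a0// /C2 ler_pM2l// lerXn2r ?nnegrE ?divr_ge0 ?ler0n//.
  rewrite ler_pdivrMr ?ltr0n// -natrM ler_nat.
  by move: K1; clear; lia.
have G_ge k : (0 < k <= K)%N -> b <= G (a k).
  move=> /andP[k0 kK]; have kD : (0 < k <= D)%N by rewrite k0 (leq_trans kK).
  have /andP[h _] := HG _ (a01 _ kD); apply: le_trans h.
  rewrite /b ler_pM2l// le_min; apply/andP; split.
    apply: ge0_ler_powR; rewrite ?nnegrE ?(ltW rho0) ?(ltW e0)//.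
      exact: ltW (u0 _ kD).
    by apply: le_trans uK_ge _; apply: udec => //; rewrite k0.
  rewrite -[leRHS](_ : 1 `^ rho = 1); last by rewrite powR1.
  by apply: ge0_ler_powR; rewrite ?nnegrE ?(ltW rho0) ?(ltW e0).
have K_le : K%:R <= b ^- 2 * \sum_i G (lam i) ^+ 2.
  rewrite mulrC ler_pdivlMr ?exprn_gt0// (sum_entry lam (fun x => G x ^+ 2)).
  apply: (@le_trans _ _ (\sum_(1 <= k < K.+1) b ^+ 2)).
    by rewrite sumr_const_nat subn1/= mulr_natl.
  apply: (@le_trans _ _ (\sum_(1 <= k < K.+1) G (a k) ^+ 2)).
    apply: ler_sum_nat => k kK; rewrite lerXn2r ?nnegrE ?(ltW b0) ?G_ge//.
    by rewrite (le_trans (ltW b0)) ?G_ge.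
  by apply: ler_sum_nat_sub => // k _; exact: sqr_ge0.
have aK0 := a0 _ K0D.
have W_le : \sum_i G (lam i) ^+ 2 * lam i ^- 2 <=
    (1 + bp ^+ 2 * Cb) * (K%:R * a K ^- 2).
  rewrite (sum_entry lam (fun x => G x ^+ 2 * x ^- 2)).
  have W1 k : (0 < k <= K)%N -> G (a k) ^+ 2 * a k ^- 2 <= a K ^- 2.
    move=> /andP[k0 kK]; have kD : (0 < k <= D)%N by rewrite k0 (leq_trans kK).
    apply: (@le_trans _ _ (1 * a k ^- 2)).
      rewrite ler_wpM2r ?invr_ge0 ?sqr_ge0//.
      by rewrite exprn_ile1 ?G0 ?G1.
    rewrite mul1r lef_pV2 ?posrE ?exprn_gt0 ?a0//.
    by rewrite lerXn2r ?nnegrE ?(ltW aK0) ?(ltW (a0 _ kD))// adec// k0.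
  have [DK|KltD] := leqP D K.
    have KE : K = D by apply/eqP; rewrite eqn_leq KD.
    apply: (@le_trans _ _ (\sum_(1 <= k < D.+1) a K ^- 2)).
      by apply: ler_sum_nat => k kD; apply: W1; rewrite KE.
    rewrite sumr_const_nat subn1/= mulrDl mul1r -KE mulr_natl lerDl.
    by rewrite mulr_ge0// mulrn_wge0// invr_ge0 sqr_ge0.
  rewrite leqNgt KltD/= in hK.
  rewrite (@big_cat_nat _ _ _ K)//=; last exact: leqW.
  rewrite mulrDl mul1r; apply: lerD.
    apply: (@le_trans _ _ (\sum_(1 <= k < K) a K ^- 2)).
      by apply: ler_sum_nat => k /andP[k1' k2']; apply: W1; rewrite k1' ltnW.
    rewrite sumr_const_nat -[leLHS]mulr_natl ler_wpM2r ?invr_ge0 ?sqr_ge0//.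
    by rewrite ler_nat leq_subr.
  (* Writing [a k ^- 2] as [t ^+ 2 * u k ^- 2] turns the terms into powers of exponent
     [2 * rho - 2]. This exceeds [nu_p] exactly because [1 + nu_p / 2 < rho]. *)
  apply: (@le_trans _ _ (\sum_(K <= k < D.+1) bp ^+ 2 * t ^+ 2 * u k `^ (2 * rho - 2))).
    apply: ler_sum_nat => k /inKD kD.
    have uk0 := u0 _ kD.
    apply: (@le_trans _ _ ((bp * u k `^ rho) ^+ 2 * a k ^- 2)).
      rewrite ler_wpM2r ?invr_ge0 ?sqr_ge0// lerXn2r ?nnegrE ?G0 ?Gu//.
      by rewrite mulr_ge0 ?powR_ge0 ?ltW.
    have -> : u k `^ (2 * rho - 2) = (u k `^ rho) ^+ 2 * u k ^- 2.
      rewrite powRB; last by rewrite (gt_eqF uk0) implybT.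
      by rewrite [2 * rho]mulrC powRrM !powR_mulrn ?powR_ge0 ?(ltW uk0).
    have tN : t != 0 by rewrite gt_eqF.
    have akN : a k != 0 by rewrite gt_eqF// a0.
    rewrite le_eqVlt; apply/orP; left; apply/eqP.
    by rewrite /u; set w := _ `^ rho; field; rewrite akN tN.
  rewrite -mulr_sumr.
  apply: (@le_trans _ _ (bp ^+ 2 * t ^+ 2 * (Cb * K%:R))).
    rewrite ler_wpM2l ?(mulr_ge0 (sqr_ge0 _) (sqr_ge0 _))//.
    apply: le_trans (HCb D lam lam01 lam_dec HS t K (ltW t0) K0D) _.
    rewrite ler_pM2l// ler_piMr// -[leRHS](_ : 1 `^ (2 * rho - 2) = 1);
      last by rewrite powR1.
    apply: ge0_ler_powR; rewrite ?nnegrE//; [lra|exact: ltW (u0 _ K0D)|exact: ltW].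
  have -> : bp ^+ 2 * t ^+ 2 * (Cb * K%:R) = bp ^+ 2 * Cb * (K%:R * t ^+ 2) by ring.
  rewrite ler_wpM2l// ler_wpM2l//.
  rewrite -exprVn lerXn2r ?nnegrE ?invr_ge0 ?(ltW t0) ?(ltW aK0)//.
  by rewrite -div1r ler_pdivlMr// ltW.
have W_ge : K%:R * a K ^- 2 <= 2 * C2 ^+ 2 * b ^- 2 *
    \sum_i G (lam i) ^+ 2 * lam i ^- 2.
  rewrite (sum_entry lam (fun x => G x ^+ 2 * x ^- 2)).
  have h0 : (0 < uphalf K)%N by case: (K) K0 => // n _; rewrite uphalfE.
  have hh : (uphalf K <= K)%N by rewrite uphalf_half; have := odd_double_half K; clear; lia.
  (* Only the upper half of the indices up to [K] is kept: at least [K / 2] of them, each with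
     [a k <= C2 * a K] and filter value at least [b]. *)
  have : \sum_(uphalf K <= k < K.+1) b ^+ 2 * (C2 ^- 2 * a K ^- 2) <=
      \sum_(1 <= k < D.+1) G (a k) ^+ 2 * a k ^- 2.
    apply: (@le_trans _ _ (\sum_(uphalf K <= k < K.+1) G (a k) ^+ 2 * a k ^- 2)).
      apply: ler_sum_nat => k /andP[hk kK].
      have k0 : (0 < k)%N := leq_trans h0 hk.
      have kD : (0 < k <= D)%N by rewrite k0 (leq_trans _ KD).
      have Gk : b <= G (a k) by rewrite G_ge// k0.
      apply: ler_pM; rewrite ?sqr_ge0 ?mulr_ge0 ?invr_ge0 ?sqr_ge0//.
        by rewrite lerXn2r ?nnegrE ?(ltW b0)// (le_trans (ltW b0)).
      rewrite -!exprVn -exprMn lerXn2r ?nnegrE ?mulr_ge0 ?invr_ge0 ?(ltW C20) ?(ltW aK0) ?(ltW (a0 _ kD))//.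
      rewrite -invfM lef_pV2 ?posrE ?mulr_gt0 ?a0//.
      have := Hc D lam lam01 lam_dec HS k K; rewrite k0 => /(_ kK KD) h.
      apply: le_trans h _; rewrite ler_pM2r// /C2 ler_pM2l// lerXn2r ?nnegrE ?divr_ge0 ?ler0n//.
      rewrite ler_pdivrMr ?ltr0n// -natrM ler_nat.
      by move: hk; rewrite uphalf_half; have := odd_double_half K; clear; lia.
    apply: ler_sum_nat_sub => //; first by rewrite h0 leqW.
    by move=> k _; rewrite mulr_ge0 ?invr_ge0 ?sqr_ge0.
  set W := \sum_(1 <= k < D.+1) _; rewrite sumr_const_nat => h.
  have hK2 : K%:R <= 2 * (K.+1 - uphalf K)%:R :> R.
    by rewrite -natrM ler_nat uphalf_half; have := odd_double_half K; clear; lia.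
  have -> : K%:R * a K ^- 2 =
      C2 ^+ 2 * b ^- 2 * (K%:R * (b ^+ 2 * (C2 ^- 2 * a K ^- 2))).
    by field; rewrite !gt_eqF.
  have -> : 2 * C2 ^+ 2 * b ^- 2 * W = C2 ^+ 2 * b ^- 2 * (2 * W) by ring.
  rewrite (ler_wpM2l (mulr_ge0 (sqr_ge0 _) k2))//.
  move: h; rewrite -[X in X <= W]mulr_natl => h.
  have X0 : 0 <= b ^+ 2 * (C2 ^- 2 * a K ^- 2).
    apply: mulr_ge0; first exact: sqr_ge0.
    by apply: mulr_ge0; rewrite invr_ge0; exact: sqr_ge0.
  apply: (@le_trans _ _ (2 * (K.+1 - uphalf K)%:R * (b ^+ 2 * (C2 ^- 2 * a K ^- 2)))).
    by rewrite ler_wpM2r.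
  by rewrite -mulrA ler_wpM2l.
have aD0 := a0 D (introT andP (conj D0 (leqnn D))).
have ell : Num.min t (a D)^-1 <= (a K)^-1 <= e^-1 * Num.min t (a D)^-1.
  apply/andP; split.
    move: hK => /orP[DK|uK1]; rewrite ge_min.
      have -> : K = D by apply/eqP; rewrite eqn_leq KD.
      by rewrite lexx orbT.
    by rewrite -[(a K)^-1]div1r ler_pdivlMr// ltW.
  rewrite -ler_pdivrMl ?invr_gt0// invrK le_min; apply/andP; split.
    by rewrite ler_pdivrMr.
  apply: (@le_trans _ _ (1 * (a K)^-1)).
    by rewrite ler_wpM2r ?invr_ge0 ?(ltW aK0).
  by rewrite mul1r lef_pV2 ?posrE// adec// K0.
have v0 : 0 <= \sum_i G (lam i) ^+ 2 by apply: sumr_ge0 => i _; exact: sqr_ge0.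
have W0 : 0 <= \sum_i G (lam i) ^+ 2 * lam i ^- 2.
  by apply: sumr_ge0 => i _; rewrite mulr_ge0 ?invr_ge0 ?sqr_ge0.
split.
- by apply: le_trans n1_le _; rewrite ler_wpM2r// /C; lra.
- by apply: le_trans K_le _; rewrite ler_wpM2r// /C; lra.
- apply: le_trans W_le _; rewrite ler_wpM2r//; last by rewrite /C; lra.
  by rewrite mulr_ge0// invr_ge0 sqr_ge0.
- by apply: le_trans W_ge _; rewrite ler_wpM2r// /C; lra.
- case/andP: ell => -> h /=; apply: le_trans h _; rewrite ler_wpM2r//.
    by rewrite le_min (ltW t0) invr_ge0 ltW.
  by rewrite /C; lra.
Qed.

(* [G] stands for [g t]. The last clause is what [t_circ <= t] is needed for: it
   excludes times so early that the filter sees none of the coefficients. *)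
Definition filter_at (R : realType) (rho bm bp : R) (D : nat) (lam : 'I_D -> R)
    (t : R) (G : R -> R) : Prop :=
  [/\ 0 < t,
      forall x, 0 < x <= 1 ->
        bm * Num.min ((t * x) `^ rho) 1 <= G x <= Num.min (bp * (t * x) `^ rho) 1 &
      1 <= \sum_i G (lam i) ^+ 2].

(** Eliminates the effective dimension [K]: each sum is compared with [K] or [K * entry lam K ^- 2],
    hence the sums with one another. The last two clauses bound the inverse problem's variance at
    later times, and in the limit where all filters are 1. *)
Lemma variance_estimates (R : realType) (rho bm bp nu_m nu_p : R) (L : nat) :
  0 < rho -> 0 < bm -> 0 < bp -> (0 < L)%N -> 0 < nu_m -> 0 < nu_p ->
  Num.max nu_p (1 + nu_p / 2) < rho ->
  exists (C : R) (Q : nat), 1 <= C /\ forall D (lam : 'I_D -> R),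
    (0 < D)%N -> (forall i, 0 < lam i <= 1) ->
    (forall i j : 'I_D, (i <= j)%N -> lam j <= lam i) ->
    assumption_S nu_m nu_p L lam ->
    forall (s : R) (G : R -> R), filter_at rho bm bp lam s G ->
    let v := \sum_i G (lam i) ^+ 2 in
    let W := \sum_i G (lam i) ^+ 2 * lam i ^- 2 in
    let m := Num.min s (entry lam D)^-1 in
    [/\ \sum_i G (lam i) <= C * v,
        W <= C * (m ^+ 2 * v),
        m ^+ 2 * v <= C * W,
        \sum_i lam i ^- 2 <= C * (W * (D%:R / v) ^+ Q) &
        forall t G', filter_at rho bm bp lam t G' ->
          v <= \sum_i G' (lam i) ^+ 2 ->
          \sum_i G' (lam i) ^+ 2 * lam i ^- 2 <=
          C * (W * ((\sum_i G' (lam i) ^+ 2) / v) ^+ Q)].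
Proof.
move=> rho0 bm0 bp0 L0 num0 nup0 hrho.
have [C [C1 HC]] := effective_dimension rho0 bm0 bp0 L0 num0 nup0 hrho.
have [c [q [c1 Hc]]] := spectrum_decay nu_p L0 num0.
have C0 : 0 < C by exact: lt_le_trans C1.
have c0 : 0 < c by exact: lt_le_trans c1.
(* [2 * q] powers come from the squared decay of the singular values, one more from the factor [k]
   in [k * a k ^- 2]. *)
pose Q := (2 * q).+1.
pose C' := C ^+ 4 + C * (c ^+ 2 * (C * ((C * C) ^+ Q))).
have Cle : C ^+ 4 <= C'.
  by rewrite lerDl !mulr_ge0 ?exprn_ge0 ?mulr_ge0 ?(ltW c0) ?(ltW C0).
have C2 : C * C <= C ^+ 4 by rewrite -expr2 ler_weXn2l.
exists C', Q; split; first by apply: le_trans Cle; rewrite exprn_ege1.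
move=> D lam D0 lam01 lam_dec HS s G sG v W m.
have [s0 HG v1] := sG; rewrite -/v in v1.
have [K /andP[K0 KD]] := HC D lam D0 lam01 lam_dec HS s G s0 HG v1.
rewrite -/v -/W -/m; set n1 := \sum_i G (lam i); set a := entry lam.
move=> [n1K Kv WK KW /andP[mK Km]].
have a0 k : (0 < k <= D)%N -> 0 < a k by exact: entry_gt0.
have K0D : (0 < K <= D)%N by rewrite K0.
have aK0 := a0 K K0D.
have aD0 : 0 < a D by rewrite a0// D0 leqnn.
have KR : 1 <= K%:R :> R by rewrite ler1n.
have v0 : 0 < v by exact: lt_le_trans v1.
have G01 i : 0 <= G (lam i) <= 1.
  have /andP[h1 h2] := HG _ (lam01 i); rewrite (le_trans _ h1)/=; last first.
    by rewrite mulr_ge0 ?(ltW bm0)// le_min powR_ge0 ler01.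
  by move: h2; rewrite le_min => /andP[].
have vn1 : v <= n1.
  by apply: ler_sum => i _; have /andP[h1 h2] := G01 i; rewrite expr2 ler_piMl.
have W0 : 0 <= W.
  by apply: sumr_ge0 => i _; apply: mulr_ge0; rewrite ?invr_ge0 sqr_ge0.
have m0 : 0 <= m by rewrite le_min (ltW s0) invr_ge0 ltW// a0// D0 leqnn.
have ell0 : 0 < (a K)^-1 by rewrite invr_gt0.
have KaK : 0 <= K%:R * a K ^- 2 by rewrite mulr_ge0// invr_ge0 sqr_ge0.
have WQ x : 1 <= x -> W <= W * x ^+ Q by move=> x1; rewrite ler_peMr// exprn_ege1.
(* An index [k] beyond [K] is at most [C * C * (w / v)] times [K]. The case [k = D], [w = D] gives
   the total sum, the effective dimension at a later time gives the growth bound. *)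
have grow k w : (K <= k <= D)%N -> k%:R <= C * w -> v <= w ->
    C * (k%:R * a k ^- 2) <= C' * (W * (w / v) ^+ Q).
  move=> /andP[Kk kD] kw vw.
  have k0D : (0 < k <= D)%N by rewrite (leq_trans K0 Kk).
  have ak0 := a0 _ k0D.
  have kK : k%:R / K%:R <= C * C * (w / v).
    rewrite ler_pdivrMr; last exact: lt_le_trans KR.
    apply: le_trans kw _.
    have -> : C * w = C * (w / v) * v by field; rewrite gt_eqF.
    have -> : C * C * (w / v) * K%:R = C * (w / v) * (C * K%:R) by ring.
    rewrite ler_wpM2l ?(le_trans vn1)//.
    by rewrite mulr_ge0 ?divr_ge0 ?(ltW C0) ?(ltW v0)// (le_trans (ltW v0)).
  have kK0 : 0 <= k%:R / K%:R :> R by rewrite divr_ge0.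
  have h : (a k)^-1 <= c * (k%:R / K%:R) ^+ q * (a K)^-1.
    rewrite -[leLHS]div1r ler_pdivrMr// mulrAC ler_pdivlMr// mul1r.
    by apply: Hc => //; rewrite K0.
  have h2 : a k ^- 2 <= c ^+ 2 * (k%:R / K%:R) ^+ (2 * q) * a K ^- 2.
    have -> : c ^+ 2 * (k%:R / K%:R) ^+ (2 * q) * a K ^- 2 =
        (c * (k%:R / K%:R) ^+ q * (a K)^-1) ^+ 2.
      by rewrite (mulnC 2 q) exprM; set z := _ ^+ q; rewrite !exprMn exprVn.
    rewrite -exprVn lerXn2r ?nnegrE ?invr_ge0 ?(ltW ak0)//.
    by rewrite !mulr_ge0 ?exprn_ge0 ?invr_ge0 ?(ltW c0) ?(ltW aK0).
  have h3 : k%:R * a k ^- 2 <=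
      c ^+ 2 * ((k%:R / K%:R) ^+ Q * (K%:R * a K ^- 2)).
    have -> : c ^+ 2 * ((k%:R / K%:R) ^+ Q * (K%:R * a K ^- 2)) =
        k%:R * (c ^+ 2 * (k%:R / K%:R) ^+ (2 * q) * a K ^- 2).
      rewrite /Q [_ ^+ (2 * q).+1]exprS; set z := (_ / _) ^+ (2 * q).
      have KN : K%:R != 0 :> R by rewrite gt_eqF// (lt_le_trans ltr01 KR).
      transitivity (k%:R * (K%:R^-1 * K%:R) * (c ^+ 2 * z * a K ^- 2)); first by ring.
      by rewrite mulVf// mulr1.
    by rewrite ler_wpM2l.
  apply: (@le_trans _ _ (C * (c ^+ 2 * ((C * C * (w / v)) ^+ Q * (C * W))))).
    rewrite ler_pM2l//; apply: le_trans h3 _; rewrite ler_wpM2l ?sqr_ge0//.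
    apply: ler_pM => //; try exact: exprn_ge0.
    by rewrite lerXn2r ?nnegrE// (le_trans kK0).
  rewrite exprMn /C' mulrDl ler_wpDl//.
    by rewrite !mulr_ge0 ?exprn_ge0 ?divr_ge0 ?(ltW C0) ?(ltW v0)// (le_trans (ltW v0)).
  by rewrite le_eqVlt; apply/orP; left; apply/eqP; ring.
have m2v : m ^+ 2 * v <= (a K)^-1 ^+ 2 * n1.
  apply: ler_pM; rewrite ?sqr_ge0 ?(ltW v0)//.
  by rewrite lerXn2r ?nnegrE ?(ltW ell0).
split.
- apply: le_trans n1K _; apply: (@le_trans _ _ (C * (C * v))); first by rewrite ler_pM2l.
  by rewrite mulrA ler_wpM2r ?(ltW v0)// (le_trans C2).
- apply: le_trans WK _.
  apply: (@le_trans _ _ (C * ((C * v) * (C * m) ^+ 2))).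
    rewrite ler_pM2l//; apply: ler_pM => //; first by rewrite invr_ge0 sqr_ge0.
    by rewrite -exprVn lerXn2r ?nnegrE ?(ltW ell0) ?mulr_ge0 ?(ltW C0).
  have -> : C * (C * v * (C * m) ^+ 2) = C ^+ 4 * (m ^+ 2 * v) by ring.
  by rewrite ler_wpM2r// mulr_ge0 ?sqr_ge0 ?(ltW v0).
- apply: le_trans m2v _; apply: (@le_trans _ _ (C * (C * W))).
    apply: (@le_trans _ _ (C * (K%:R * a K ^- 2))).
      by rewrite mulrA -exprVn mulrC ler_wpM2r ?sqr_ge0.
    by rewrite ler_pM2l.
  by rewrite mulrA ler_wpM2r// (le_trans C2).
- have h : \sum_i lam i ^- 2 <= C * (D%:R * a D ^- 2).
    apply: (@le_trans _ _ (\sum_(i < D) a D ^- 2)).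
      apply: ler_sum => i _; have /andP[l0 _] := lam01 i.
      rewrite lef_pV2 ?posrE ?exprn_gt0//.
      by rewrite lerXn2r ?nnegrE ?(ltW l0) ?entry_ge0// entryD_le.
    rewrite sumr_const card_ord -[leLHS]mulr_natl ler_peMl//.
    by rewrite mulr_ge0// invr_ge0 sqr_ge0.
  apply: le_trans h _; apply: grow; rewrite ?KD//=.
    by rewrite ler_peMl.
  have -> : D%:R = \sum_(i < D) 1 :> R by rewrite sumr_const card_ord.
  apply: ler_sum => i _.
  by have /andP[g0 g1] := G01 i; rewrite exprn_ile1.
- move=> t G' [t0 HG' v'1] vv'; pose v' := \sum_i G' (lam i) ^+ 2.
  have [K' /andP[K'0 K'D]] := HC D lam D0 lam01 lam_dec HS t G' t0 HG' v'1.
  rewrite -/v'; move=> [_ K'v' W'K' _ _]; apply: le_trans W'K' _.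
  have [K'K|KK'] := leqP K' K; last by apply: grow; rewrite ?(ltnW KK').
  have aKK' : a K <= a K' by apply: entry_dec; rewrite ?K'0.
  apply: (@le_trans _ _ (C * (C * W))).
    rewrite ler_pM2l//; apply: le_trans KW; apply: ler_pM => //.
    + by rewrite invr_ge0 sqr_ge0.
    + by rewrite ler_nat.
    + rewrite lef_pV2 ?posrE ?exprn_gt0 ?a0 ?K'0//.
      by rewrite lerXn2r ?nnegrE ?(ltW aK0)// (le_trans (ltW aK0)).
  rewrite mulrA; apply: ler_pM => //; first by rewrite mulr_ge0 ?(ltW C0).
    exact: le_trans C2 Cle.
  by apply: WQ; rewrite ler_pdivlMr// mul1r.
Qed.

(** * Stopping times *)

Section StoppingTimes.
Context {R : realType}.

Lemma cvg_sumr (T : Type) (F : set_system T) (FF : Filter F) (I : Type)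
    (r : seq I) (f : I -> T -> R) (l : I -> R) :
  (forall i, f i t @[t --> F] --> l i) ->
  \sum_(i <- r) f i t @[t --> F] --> \sum_(i <- r) l i.
Proof.
move=> fl; elim: r => [|i r IHr].
  by rewrite big_nil; under eq_fun do rewrite big_nil; exact: cvg_cst.
rewrite big_cons; under eq_fun do rewrite big_cons.
exact: (cvgD (fl i) IHr).
Qed.

(** The shape [c * (a + b * x) ^+ 2] covers variances ([a = 0], [b = 1]) as well as biases and
    residuals ([a = 1], [b = -1]). *)
Lemma cvg_sum_sqr (T : Type) (F : set_system T) (FF : Filter F) (I : finType)
    (c : I -> R) (a b : R) (f : I -> T -> R) (l : I -> R) :
  (forall i, f i t @[t --> F] --> l i) ->
  \sum_i c i * (a + b * f i t) ^+ 2 @[t --> F] --> \sum_i c i * (a + b * l i) ^+ 2.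
Proof.
move=> fl; apply: cvg_sumr => i; apply: cvgM; first exact: cvg_cst.
apply: (@cvg_comp _ _ _ (fun t => a + b * f i t) (fun x : R => x ^+ 2)); last exact: exprn_continuous.
apply: cvgD; first exact: cvg_cst.
by apply: cvgM; [exact: cvg_cst|exact: fl].
Qed.

(** If [f] exceeded [k] at the infimum, it would do so nearby by continuity, contradicting points of
    [S] just to the right. Nonemptiness excludes the default value 0 of [inf]. *)
Lemma inf_closed (f : R -> R) (S : set R) (k : R) :
  {within `[0, +oo[, continuous f} -> S !=set0 ->
  (forall t, S t -> 0 <= t /\ f t <= k) ->
  0 <= inf S /\ f (inf S) <= k.
Proof.
move=> cf S0 Sk; have infS : has_inf S.
  by split=> //; exists 0 => t /Sk[].
have inf0 : 0 <= inf S by apply: lb_le_inf => // t /Sk[].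
split => //; rewrite leNgt; apply/negP => fk.
have /subspace_continuousP/(_ (inf S)) := cf; rewrite /= in_itv/= inf0.
move=> /(_ isT) /cvgr_gt/(_ _ fk).
rewrite nearE /within/= => -[e /= e0 He].
have [t St te] := inf_adherent e0 infS.
have [t0 ft] := Sk _ St.
have it : inf S <= t by apply: ge_inf => //; case: infS.
suff : k < f t by rewrite ltNge ft.
apply: (He t) => /=; last by rewrite in_itv/= t0.
by rewrite distrC ger0_norm ?subr_ge0// ltrBlDl.
Qed.

Lemma inf_lt_notin (S : set R) (t : R) : has_lbound S -> t < inf S -> ~ S t.
Proof.
by move=> lS tS St; move: tS; rewrite ltNge ge_inf.
Qed.

Context {D : nat}.
Variables (g : R -> R -> R) (lam : 'I_D -> R).
Hypotheses (hR1 : assumption_R1 g) (lam01 : forall i, 0 < lam i <= 1).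

Let lam0 i : 0 <= lam i. Proof. by case/andP: (lam01 i) => /ltW. Qed.

Lemma filter_bound t i : 0 <= t -> 0 <= g t (lam i) <= 1.
Proof. by move=> t0; have [h _ _ _] := hR1; exact: h t0 (lam0 i). Qed.

Lemma filter_mono s t i : 0 <= s -> s <= t -> g s (lam i) <= g t (lam i).
Proof. by move=> s0 st; have [_ h _ _] := hR1; exact: h (lam0 i) s0 st. Qed.

Lemma sum_sqr_continuous (c : 'I_D -> R) (a b : R) :
  {within `[0, +oo[, continuous
    (fun t => \sum_i c i * (a + b * g t (lam i)) ^+ 2)}.
Proof.
move=> x; apply: cvg_sum_sqr => i.
have [_ _ _ h] := hR1; have [|cg _ _] := h (lam i); first by case/andP: (lam01 i).
exact: cg.
Qed.

Lemma sum_sqr_limit (c : 'I_D -> R) (a b : R) :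
  \sum_i c i * (a + b * g t (lam i)) ^+ 2 @[t --> +oo] -->
  \sum_i c i * (a + b) ^+ 2.
Proof.
rewrite -[X in (a + X)]mulr1; apply: cvg_sum_sqr => i.
have [_ _ _ h] := hR1; have [|_ _ //] := h (lam i); by case/andP: (lam01 i).
Qed.

Lemma wvarE (delta : R) t :
  wvar delta (fun t i => g t (lam i)) t =
  \sum_i delta ^+ 2 * (0 + 1 * g t (lam i)) ^+ 2.
Proof. by rewrite /wvar mulr_sumr; apply: eq_bigr => i _; ring. Qed.

Lemma svarE (delta : R) t :
  svar delta (fun t i => g t (lam i)) lam t =
  \sum_i delta ^+ 2 * lam i ^- 2 * (0 + 1 * g t (lam i)) ^+ 2.
Proof. by rewrite /svar mulr_sumr; apply: eq_bigr => i _; ring. Qed.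

Lemma residual2E (Y : 'I_D -> R) t :
  residual2 (fun t i => g t (lam i)) Y t =
  \sum_i Y i ^+ 2 * (1 + -1 * g t (lam i)) ^+ 2.
Proof. by apply: eq_bigr => i _; ring. Qed.

(** The biases are residuals of noiseless data, so they inherit monotonicity, continuity and limits
    from [residual2]. *)
Lemma wbias2_residual2 (mu : 'I_D -> R) :
  wbias2 (fun t i => g t (lam i)) lam mu =
  residual2 (fun t i => g t (lam i)) (fun i => lam i * mu i).
Proof. by apply/funext => t; apply: eq_bigr => i _; ring. Qed.

Lemma sbias2_residual2 (mu : 'I_D -> R) :
  sbias2 (fun t i => g t (lam i)) mu = residual2 (fun t i => g t (lam i)) mu.
Proof. by []. Qed.

Lemma residual2_dec (Y : 'I_D -> R) s t : 0 <= s -> s <= t ->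
  residual2 (fun t i => g t (lam i)) Y t <= residual2 (fun t i => g t (lam i)) Y s.
Proof.
move=> s0 st; apply: ler_sum => i _; rewrite ler_wpM2r ?sqr_ge0//.
have t0 := le_trans s0 st.
have /andP[_ gt1] := filter_bound i t0; have /andP[_ gs1] := filter_bound i s0.
rewrite lerXn2r ?nnegrE ?subr_ge0//.
by rewrite lerB// filter_mono.
Qed.

Lemma wvar_nondec (delta : R) s t : 0 <= s -> s <= t ->
  wvar delta (fun t i => g t (lam i)) s <= wvar delta (fun t i => g t (lam i)) t.
Proof.
move=> s0 st; rewrite ler_wpM2l ?sqr_ge0//; apply: ler_sum => i _.
have t0 := le_trans s0 st.
have /andP[g0 _] := filter_bound i t0; have /andP[h0 _] := filter_bound i s0.
by rewrite lerXn2r ?nnegrE// filter_mono.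
Qed.

Lemma svar_nondec (delta : R) s t : 0 <= s -> s <= t ->
  svar delta (fun t i => g t (lam i)) lam s <=
  svar delta (fun t i => g t (lam i)) lam t.
Proof.
move=> s0 st; rewrite ler_wpM2l ?sqr_ge0//; apply: ler_sum => i _.
have t0 := le_trans s0 st.
have /andP[g0 _] := filter_bound i t0; have /andP[h0 _] := filter_bound i s0.
by rewrite ler_wpM2r ?invr_ge0 ?sqr_ge0// lerXn2r ?nnegrE// filter_mono.
Qed.

(** All filters tend to 1. This makes the sets defining [tau], [t_weak] and [t_strong] nonempty. *)
Lemma residual2_below (Y : 'I_D -> R) (t0 e : R) : 0 < e ->
  exists2 t, t0 <= t & residual2 (fun t i => g t (lam i)) Y t <= e.
Proof.
move=> e0; have := @sum_sqr_limit (fun i => Y i ^+ 2) 1 (-1).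
rewrite big1; last by move=> i _; rewrite subrr expr0n mulr0.
move=> /cvgr_lt/(_ _ e0) h.
have [t t0t ht] := pinfty_ex_ge (num_real t0) h.
by exists t => //; rewrite residual2E ltW.
Qed.

Lemma sum_sqr_level (s y : R) : 0 <= s ->
  \sum_i g s (lam i) ^+ 2 <= y -> y < D%:R ->
  exists2 t, s <= t & \sum_i g t (lam i) ^+ 2 = y.
Proof.
move=> s0 sy yD.
have vE t : \sum_i g t (lam i) ^+ 2 = \sum_i 1 * (0 + 1 * g t (lam i)) ^+ 2.
  by apply: eq_bigr => i _; rewrite !mul1r add0r.
have := @sum_sqr_limit (fun=> 1) 0 1.
have -> : \sum_(i < D) 1 * (0 + 1) ^+ 2 = D%:R :> R.
  rewrite (eq_bigr (fun=> 1)); last by move=> i _; rewrite add0r expr1n mulr1.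
  by rewrite sumr_const card_ord.
move=> /cvgr_gt/(_ _ yD) h; have [t st ht] := pinfty_ex_ge (num_real s) h.
have yt : y <= \sum_i g t (lam i) ^+ 2 by rewrite vE ltW.
have [||c] := @IVT R (fun t => \sum_i 1 * (0 + 1 * g t (lam i)) ^+ 2) s t y st.
- apply: continuous_subspaceW (@sum_sqr_continuous (fun=> 1) 0 1).
  by move=> x /=; rewrite !in_itv/= => /andP[sx _]; rewrite (le_trans s0).
- by rewrite -!vE ge_min le_max sy yt orbT.
by rewrite in_itv/= -vE => /andP[sc _] hc; exists c.
Qed.

End StoppingTimes.

(** * The oracle inequality *)

Section Decomposition.
Context {R : realType} {D : nat}.
Variables (delta kappa : R) (lam mu x : 'I_D -> R) (g : R -> R -> R).
Hypotheses (hR1 : assumption_R1 g) (lam01 : forall i, 0 < lam i <= 1).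
Hypothesis delta0 : 0 < delta.
Let gam (t : R) (i : 'I_D) : R := g t (lam i).
Let Y (i : 'I_D) : R := lam i * mu i + delta * x i.

(** The centred part of the residual in units of [delta ^+ 2], arranged as the quadratic-plus-linear
    form whose exponential moment is known. *)
Definition residual_noise (delta : R) (gam : R -> 'I_D -> R)
    (lam mu x : 'I_D -> R) (t : R) : R :=
  \sum_i ((1 - gam t i) ^+ 2 * (x i ^+ 2 - 1) +
          2 * (1 - gam t i) ^+ 2 * (lam i * mu i / delta) * x i).

Lemma residual2_noise t :
  residual2 gam Y t = wbias2 gam lam mu t +
    delta ^+ 2 * \sum_i (1 - gam t i) ^+ 2 +
    delta ^+ 2 * residual_noise delta gam lam mu x t.
Proof.
rewrite !mulr_sumr -!big_split/=; apply: eq_bigr => i _.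
by rewrite /Y; field; rewrite gt_eqF.
Qed.

(** Stated for each realisation, so that [t] may be the random time [tau], for which bias and noise
    are not independent. *)
Lemma sqnorm_error_le t :
  sqnorm (fun i => estimator gam lam Y t i - mu i) <=
  2 * sbias2 gam mu t +
  2 * (delta ^+ 2 * \sum_i gam t i ^+ 2 * lam i ^- 2 * x i ^+ 2).
Proof.
rewrite /sqnorm !mulr_sumr -big_split/=; apply: ler_sum => i _.
have l0 : lam i != 0 by have /andP[h _] := lam01 i; rewrite gt_eqF.
set p := (1 - gam t i) * mu i; set q := gam t i * (lam i)^-1 * (delta * x i).
have -> : estimator gam lam Y t i - mu i = q - p.
  by rewrite /estimator /Y /q /p; field.
have -> : 2 * ((1 - gam t i) ^+ 2 * mu i ^+ 2) = 2 * p ^+ 2 by rewrite /p; ring.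
have -> : 2 * (delta ^+ 2 * (gam t i ^+ 2 * lam i ^- 2 * x i ^+ 2)) = 2 * q ^+ 2.
  by rewrite /q; field.
by have := sqr_ge0 (p + q); nra.
Qed.

(** For filter values [a] at [t] and [b] at [s], [(1 - a) * lam * mu] is a remaining bias [p], plus
    an observed increment [q], minus its noise [r]. As [0 <= a <= b <= 1], [(b - a) ^+ 2] is at most
    [(1 - a) ^+ 2 - (1 - b) ^+ 2], so the [q] terms sum to at most the drop of the residual, and
    also at most [b ^+ 2], which handles [r]. *)
Lemma wbias2_stopped_le s t : 0 <= t -> t <= s -> residual2 gam Y t <= kappa ->
  wbias2 gam lam mu t <= 3 * wbias2 gam lam mu s +
    3 * Num.max (kappa - residual2 gam Y s) 0 +
    3 * (delta ^+ 2 * \sum_i gam s i ^+ 2 * x i ^+ 2).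
Proof.
move=> t0 ts Rt.
have : residual2 gam Y t - residual2 gam Y s <= Num.max (kappa - residual2 gam Y s) 0.
  by rewrite le_max lerB.
rewrite -sumrB => h.
apply: (@le_trans _ _ (3 * wbias2 gam lam mu s +
    3 * \sum_i ((1 - gam t i) ^+ 2 * Y i ^+ 2 - (1 - gam s i) ^+ 2 * Y i ^+ 2) +
    3 * (delta ^+ 2 * \sum_i gam s i ^+ 2 * x i ^+ 2))); last by lra.
rewrite !mulr_sumr -!big_split/=; apply: ler_sum => i _.
have s0 := le_trans t0 ts.
have /andP[gt0 gt1] := filter_bound hR1 lam01 i t0.
have /andP[gs0 gs1] := filter_bound hR1 lam01 i s0.
have gts := filter_mono hR1 lam01 i t0 ts.
rewrite -/(gam t i) -/(gam s i) in gt0 gt1 gs0 gs1 gts *.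
set a := gam t i in gt0 gt1 gts *; set b := gam s i in gs0 gs1 gts *.
set p := (1 - b) * (lam i * mu i); set q := (b - a) * Y i.
set r := (b - a) * (delta * x i).
have e1 : (1 - a) ^+ 2 * lam i ^+ 2 * mu i ^+ 2 = (p + q - r) ^+ 2.
  by rewrite /p /q /r /Y; ring.
have e2 : (1 - b) ^+ 2 * lam i ^+ 2 * mu i ^+ 2 = p ^+ 2 by rewrite /p; ring.
have e3 : q ^+ 2 <= (1 - a) ^+ 2 * Y i ^+ 2 - (1 - b) ^+ 2 * Y i ^+ 2.
  rewrite /q exprMn -mulrBl ler_wpM2r ?sqr_ge0//.
  nra.
have e4 : r ^+ 2 <= delta ^+ 2 * (b ^+ 2 * x i ^+ 2).
  have -> : delta ^+ 2 * (b ^+ 2 * x i ^+ 2) = b ^+ 2 * (delta * x i) ^+ 2 by ring.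
  rewrite /r exprMn ler_wpM2r ?sqr_ge0//.
  nra.
have e5 : (p + q - r) ^+ 2 <= 3 * p ^+ 2 + 3 * q ^+ 2 + 3 * r ^+ 2.
  have h1 := sqr_ge0 (p - q); have h2 := sqr_ge0 (p + r); have h3 := sqr_ge0 (q + r).
  nra.
rewrite e1 e2; lra.
Qed.

End Decomposition.

Section BiasSplit.
Context {R : realType} {D : nat}.
Variables (rho bm bp : R) (lam mu : 'I_D -> R) (g : R -> R -> R).
Hypotheses (rho0 : 0 < rho) (bp0 : 0 < bp).
Hypotheses (hR1 : assumption_R1 g) (lam01 : forall i, 0 < lam i <= 1).
Hypothesis lam_dec : forall i j : 'I_D, (i <= j)%N -> lam j <= lam i.
Let gam (t : R) (i : 'I_D) : R := g t (lam i).

(** The inner power is the value of [s * lam i] at which the upper bound [bp * (s * lam i) ^ rho] of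
    the filter equals 1/2. *)
Definition bias_constant (rho bp : R) : R :=
  (1 + ((2 * bp)^-1 `^ rho^-1)^-1) ^+ 2.

(* Where [s * lam i] is small the filter at time [s] leaves at least half of the
   signal; elsewhere [(lam i)^-1] is at most a multiple of [min s lam_D^-1]. *)
Lemma sbias2_split s t : filter_at rho bm bp lam s (g s) -> 0 <= t ->
  sbias2 gam mu t <= 4 * sbias2 gam mu s + bias_constant rho bp *
    (Num.min s (entry lam D)^-1 ^+ 2 * wbias2 gam lam mu t).
Proof.
move=> [s0 Hs _] t0; rewrite /bias_constant.
set cb := (2 * bp)^-1 `^ rho^-1; set m := Num.min _ _.
have bp2 : 0 < (2 * bp)^-1 by rewrite invr_gt0 mulr_gt0.
have cb0 : 0 < cb by rewrite powR_gt0.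
have cbV : 0 < cb^-1 by rewrite invr_gt0.
rewrite !mulr_sumr -big_split/=; apply: ler_sum => i _.
have /andP[gt0 gt1] := filter_bound hR1 lam01 i t0.
have /andP[gs0 gs1] := filter_bound hR1 lam01 i (ltW s0).
rewrite -/(gam t i) -/(gam s i) in gt0 gt1 gs0 gs1 *.
have /andP[l0 l1] := lam01 i.
have iD : (0 < D)%N := leq_ltn_trans (leq0n i) (ltn_ord i).
have aD0 : 0 < entry lam D by apply: entry_gt0; rewrite // iD leqnn.
have m0 : 0 <= m by rewrite le_min (ltW s0) invr_ge0 ltW.
have mu0 := sqr_ge0 (mu i).
have [small|large] := leP (bp * (s * lam i) `^ rho) (1 / 2).
  have gs2 : gam s i <= 1 / 2.
    apply: le_trans small; have /andP[_] := Hs _ (lam01 i).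
    by rewrite le_min => /andP[].
  apply: (@le_trans _ _ (4 * ((1 - gam s i) ^+ 2 * mu i ^+ 2))).
    by rewrite mulrA ler_wpM2r//; nra.
  rewrite lerDl; apply: mulr_ge0 (sqr_ge0 _) (mulr_ge0 (sqr_ge0 _) _).
  exact: mulr_ge0 (mulr_ge0 (sqr_ge0 _) (sqr_ge0 _)) (sqr_ge0 _).
have sl0 : 0 < s * lam i by rewrite mulr_gt0.
have sl : cb <= s * lam i.
  have -> : s * lam i = ((s * lam i) `^ rho) `^ rho^-1.
    by rewrite -powRrM divff ?gt_eqF// powRr1// ltW.
  apply: ge0_ler_powR; rewrite ?nnegrE ?powR_ge0 ?invr_ge0 ?(ltW rho0) ?(ltW bp2)//.
    by rewrite -invr_ge0 ltW.
  rewrite -[leLHS]div1r ler_pdivrMr ?mulr_gt0//.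
  by move: large; set z := _ `^ rho; lra.
have lV : (lam i)^-1 <= (1 + cb^-1) * m.
  rewrite minr_pMr ?addr_ge0 ?(ltW cbV)// le_min; apply/andP; split.
    apply: (@le_trans _ _ (cb^-1 * s)).
      by rewrite -[leLHS]div1r ler_pdivrMr// -mulrA ler_pdivlMl// mulr1.
    by rewrite ler_wpM2r ?(ltW s0)// lerDr.
  apply: (@le_trans _ _ (entry lam D)^-1).
    by rewrite lef_pV2 ?posrE// entryD_le.
  by rewrite ler_peMl ?invr_ge0 ?(ltW aD0)// lerDl ltW.
apply: (@le_trans _ _ ((1 + cb^-1) ^+ 2 *
    (m ^+ 2 * ((1 - gam t i) ^+ 2 * lam i ^+ 2 * mu i ^+ 2)))); last first.
  by rewrite lerDr mulr_ge0// (mulr_ge0 (sqr_ge0 _) (sqr_ge0 _)).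
have -> : (1 + cb^-1) ^+ 2 * (m ^+ 2 * ((1 - gam t i) ^+ 2 * lam i ^+ 2 * mu i ^+ 2)) =
  ((1 + cb^-1) * m * lam i) ^+ 2 * ((1 - gam t i) ^+ 2 * mu i ^+ 2) by ring.
rewrite (ler_peMl (mulr_ge0 (sqr_ge0 _) (sqr_ge0 _)))// exprn_ege1//.
by rewrite -ler_pdivrMr// div1r.
Qed.

End BiasSplit.

(* [16] is the bound of [mean_le_sqr], [258 = 256 + 2] the sum of the bounds of
   [mean_le_fourth] and [mean_le_exp]. *)
Definition level_constant (R : realType) (Q : nat) : R :=
  16 * 4 ^+ Q.+1 + 258 * (32 * Q.+1%:R) ^+ Q.+1.

(** Raise [z / n <= expR (z / n)] to the power [n]. *)
Lemma expRN_le_powV (R : realType) (n : nat) (z : R) : (0 < n)%N -> 0 < z ->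
  expR (- z) <= (n%:R / z) ^+ n.
Proof.
move=> n0 z0; have nR : 0 < n%:R :> R by rewrite ltr0n.
rewrite expRN -[n%:R / z]invf_div exprVn lef_pV2 ?posrE ?expR_gt0 ?exprn_gt0 ?divr_gt0//.
have -> : z = n%:R * (z / n%:R) by field; rewrite gt_eqF.
rewrite expRM_natl lerXn2r ?nnegrE ?expR_ge0//; first last.
  by apply: le_trans (expR_ge1Dx _); rewrite mulrC mulKf ?gt_eqF//; lra.
by rewrite mulrC mulKf ?gt_eqF// divr_ge0 ?ltW.
Qed.

Lemma level_constant_ge0 (R : realType) (Q : nat) : 0 <= level_constant R Q.
Proof.
exact: addr_ge0 (mulr_ge0 (ler0n R 16) (exprn_ge0 _ (ler0n R 4)))
  (mulr_ge0 (ler0n R 258) (exprn_ge0 _ (mulr_ge0 (ler0n R 32) (ler0n R _)))).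
Qed.

(** The exponential is traded for the power [Q + 1], one more than the growth of the variance, which
    leaves a summable factor [2 ^- j]. Levels below 3 are covered by [2 ^+ j <= 4]. *)
Lemma level_constantP (R : realType) (Q j : nat) :
  (if (j < 3)%N then 16 else 258 * expR (- (2 ^+ j.-1 / 16))) * (2 ^+ j) ^+ Q <=
  level_constant R Q * (2^-1) ^+ j.
Proof.
have y0 : 0 < 2 ^+ j :> R by rewrite exprn_gt0.
rewrite exprVn ler_pdivlMr// -mulrA -exprSr /level_constant.
case: ltnP => j3.
  apply: (@le_trans _ _ (16 * 4 ^+ Q.+1)); last first.
    rewrite lerDl.
    exact: mulr_ge0 (ler0n R 258) (exprn_ge0 _ (mulr_ge0 (ler0n R 32) (ler0n R _))).
  rewrite ler_pM2l// lerXn2r ?nnegrE ?(ltW y0)//.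
  have -> : 4 = 2 ^+ 2 :> R by rewrite -natrX.
  by rewrite ler_weXn2l// ler1n.
apply: (@le_trans _ _ (258 * (32 * Q.+1%:R) ^+ Q.+1)); last first.
  by rewrite lerDr; exact: mulr_ge0 (ler0n R 16) (exprn_ge0 _ (ler0n R 4)).
rewrite -mulrA (ler_pM2l (ltr0n R 258 : 0 < 258)).
have -> : 2 ^+ j.-1 / 16 = 2 ^+ j / 32 :> R.
  by rewrite -(prednK (leq_trans _ j3 : (0 < j)%N))// exprS; lra.
apply: (@le_trans _ _ ((Q.+1%:R / (2 ^+ j / 32)) ^+ Q.+1 * (2 ^+ j) ^+ Q.+1)).
  by rewrite ler_wpM2r ?exprn_ge0 ?(ltW y0)// expRN_le_powV// divr_gt0.
rewrite -exprMn le_eqVlt; apply/orP; left; apply/eqP; congr (_ ^+ _).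
by field; rewrite gt_eqF.
Qed.

Lemma sum_half_le (R : realType) (n : nat) : \sum_(j < n) (2^-1) ^+ j <= 2 :> R.
Proof.
suff -> : \sum_(j < n) (2^-1) ^+ j = 2 - 2 * (2^-1) ^+ n :> R.
  by rewrite gerBl mulr_ge0// exprn_ge0// invr_ge0.
elim: n => [|n IHn]; first by rewrite big_ord0 expr0; lra.
by rewrite big_ord_recr/= IHn exprS; lra.
Qed.

(** Collects twice the constants of [bias_bound] and of [stochastic_bound]. *)
Definition oracle_constant (R : realType) (rho bp C : R) (Q : nat) : R :=
  8 + 6 * bias_constant rho bp * (26 + 2 * C) * C + 4 * C * level_constant R Q.

(** * Risk at [tau] against bias and variance at a fixed time [s] *)

Section KeyInequality.
Context {R : realType} {d : measure_display} {T : measurableType d}.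
Context {P : probability T R} {D : nat}.
Variables (eps : 'I_D -> {RV P >-> R}) (delta kappa Co Ck rho bm bp C : R) (Q : nat).
Variables (lam mu : 'I_D -> R) (g : R -> R -> R) (s : R).
Let gam (t : R) (i : 'I_D) : R := g t (lam i).
Let Y (w : T) : 'I_D -> R := observation delta lam mu eps w.
Let noise (t : R) (w : T) : R :=
  residual_noise delta gam lam mu (fun i => eps i w) t.
Let tc := t_circ Co delta gam.
Let v (t : R) : R := \sum_i gam t i ^+ 2.
Let W : R := \sum_i gam s i ^+ 2 * lam i ^- 2.
Let m : R := Num.min s (entry lam D)^-1.
Let rD : R := Num.sqrt D%:R.
Hypotheses (D0 : (0 < D)%N) (delta0 : 0 < delta) (kappa0 : 0 < kappa).
Hypotheses (ind_eps : mutually_independent eps).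
Hypotheses (normal_eps : forall i, standard_normal (eps i)).
Hypotheses (hR1 : assumption_R1 g) (lam01 : forall i, 0 < lam i <= 1).
Hypothesis lam_dec : forall i j : 'I_D, (i <= j)%N -> lam j <= lam i.
Hypotheses (rho0 : 0 < rho) (bp0 : 0 < bp) (Co1 : 1 <= Co) (CkCo : Ck <= Co).
Hypothesis hkappa : `|kappa - D%:R * delta ^+ 2| <= Ck * rD * delta ^+ 2.
Hypothesis tc0 : 0 < tc.
Hypothesis late_filter : forall t, tc <= t -> filter_at rho bm bp lam t (g t).
Hypothesis late_var : forall t, tc <= t -> Co * rD <= v t.
Hypothesis tcs : tc <= s.
Hypothesis balance : wbias2 gam lam mu s <= wvar delta gam s.
Hypothesis C1 : 1 <= C.
Hypothesis n1_le : \sum_i gam s i <= C * v s.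
Hypothesis W_ge : m ^+ 2 * v s <= C * W.
Hypothesis W_total : \sum_i lam i ^- 2 <= C * (W * (D%:R / v s) ^+ Q).
Hypothesis W_growth : forall t, s <= t -> v s <= v t ->
  \sum_i gam t i ^+ 2 * lam i ^- 2 <= C * (W * (v t / v s) ^+ Q).

Let rD1 : 1 <= rD.
Proof. by rewrite -[leLHS]sqrtr1 ler_wsqrtr// ler1n. Qed.
Let rD0 : 0 < rD. Proof. exact: lt_le_trans rD1. Qed.
Let rDD : rD ^+ 2 = D%:R. Proof. by rewrite sqr_sqrtr. Qed.
(** The residual noise fluctuates on the scale [rD]. This tilt satisfies [theta <= 1 / 4] and
    [4 * theta ^+ 2 * (2 * D) = 1 / 2], the two conditions of [mean_le_exp]. *)
Let theta : R := (4 * rD)^-1.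
Let theta0 : 0 < theta. Proof. by rewrite invr_gt0 mulr_gt0. Qed.
Let s0 : 0 < s. Proof. exact: lt_le_trans tc0 tcs. Qed.
Let vs_ge : rD <= v s.
Proof. by apply: le_trans (late_var tcs); rewrite ler_peMl// ltW. Qed.
Let vs0 : 0 < v s. Proof. exact: lt_le_trans rD0 vs_ge. Qed.
Let gam_ge0 t i : 0 <= t -> 0 <= gam t i.
Proof. by move=> t0; have /andP[] := filter_bound hR1 lam01 i t0. Qed.
Let gam_le1 t i : 0 <= t -> gam t i <= 1.
Proof. by move=> t0; have /andP[] := filter_bound hR1 lam01 i t0. Qed.
Let v_leD t : 0 <= t -> v t <= D%:R.
Proof.
move=> t0; have -> : D%:R = \sum_(i < D) 1 :> R by rewrite sumr_const card_ord.
by apply: ler_sum => i _; rewrite exprn_ile1 ?gam_ge0 ?gam_le1.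
Qed.
Let wbias_le t : s <= t -> wbias2 gam lam mu t <= delta ^+ 2 * v s.
Proof.
move=> st; apply: le_trans balance.
by rewrite wbias2_residual2; exact: residual2_dec (ltW s0) st.
Qed.
Let W0 : 0 <= W.
Proof. by apply: sumr_ge0 => i _; apply: mulr_ge0; rewrite ?invr_ge0 sqr_ge0. Qed.

(** The sign [e] treats upper and lower deviations together. From [s] on the weak bias is at most
    [delta ^+ 2 * D], so the linear part contributes no more than the bound [D] used for the
    quadratic part. *)
Let noise_exp e t : e = 1 \/ e = -1 -> s <= t ->
  mean_le P (fun w => expR (e * theta * noise t w)) 2.
Proof.
move=> e1 st; have t0 := le_trans (ltW s0) st.
have e2 : e ^+ 2 = 1 by case: e1 => ->; rewrite ?sqrrN expr1n.
have en : `|e| = 1 by case: e1 => ->; rewrite ?normrN normr1.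
pose a i := e * theta * (1 - gam t i) ^+ 2.
pose b i := e * theta * (2 * (1 - gam t i) ^+ 2 * (lam i * mu i / delta)).
have c01 i : 0 <= (1 - gam t i) ^+ 2 <= 1.
  by rewrite sqr_ge0 exprn_ile1// ?subr_ge0 ?gam_le1// lerBlDr lerDl gam_ge0.
have a4 i : `|a i| <= 1 / 4.
  have /andP[h0 h1] := c01 i.
  rewrite /a (normrM (e * theta)) (normrM e) en (gtr0_norm theta0) (ger0_norm h0) (mul1r theta).
  apply: (@le_trans _ _ (theta * 1)); first by rewrite ler_pM2l.
  by rewrite mulr1 /theta div1r lef_pV2 ?posrE ?mulr_gt0// ler_peMr.
have th2 : 0 <= 4 * theta ^+ 2 by rewrite mulr_ge0// sqr_ge0.
have ab : \sum_i (4 * a i ^+ 2 + b i ^+ 2) <= 1 / 2.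
  apply: (@le_trans _ _ (\sum_i 4 * theta ^+ 2 *
      (1 + (1 - gam t i) ^+ 2 * lam i ^+ 2 * mu i ^+ 2 / delta ^+ 2))).
    apply: ler_sum => i _; have /andP[h0 h1] := c01 i.
    set z := (1 - gam t i) ^+ 2 in h0 h1 *.
    have -> : 4 * a i ^+ 2 + b i ^+ 2 =
      e ^+ 2 * (4 * theta ^+ 2 * (z * z + z * z * lam i ^+ 2 * mu i ^+ 2 / delta ^+ 2)).
      by rewrite /a /b -/z; field; rewrite gt_eqF.
    rewrite e2 mul1r (ler_wpM2l th2)//.
    have zz : z * z <= 1 * z by rewrite ler_wpM2r.
    apply: lerD; first by rewrite (le_trans zz)// mul1r.
    rewrite ler_wpM2r ?invr_ge0 ?sqr_ge0// ler_wpM2r ?sqr_ge0// ler_wpM2r ?sqr_ge0//.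
    by rewrite mul1r in zz.
  rewrite -mulr_sumr big_split/= -mulr_suml sumr_const card_ord -/(wbias2 gam lam mu t).
  have wb : wbias2 gam lam mu t / delta ^+ 2 <= D%:R.
    rewrite ler_pdivrMr ?exprn_gt0// mulrC (le_trans (wbias_le st))//.
    by rewrite ler_pM2l ?exprn_gt0// v_leD// ltW.
  have -> : 1 / 2 = 4 * theta ^+ 2 * (2 * D%:R).
    by rewrite /theta -rDD; field; rewrite gt_eqF.
  by rewrite (ler_wpM2l th2)//; lra.
apply: (mean_le_trans (mean_le_exp ind_eps normal_eps a4 ab)) => // w.
rewrite le_eqVlt; apply/orP; left; apply/eqP; congr expR.
by rewrite /noise mulr_sumr; apply: eq_bigr => i _; rewrite /a /b; ring.
Qed.

(** As [Ck * rD <= Co * rD <= v s], the distance of the threshold from [D * delta ^+ 2] is at most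
    the weak variance at [s]. *)
Let kappa_lo : D%:R * delta ^+ 2 - v s * delta ^+ 2 <= kappa.
Proof.
have := hkappa; rewrite ler_norml => /andP[h _].
have : Ck * rD * delta ^+ 2 <= v s * delta ^+ 2.
  rewrite ler_pM2r ?exprn_gt0//; apply: le_trans (late_var tcs).
  by rewrite ler_wpM2r// ltW.
lra.
Qed.

Let kappa_hi : kappa <= D%:R * delta ^+ 2 + v s * delta ^+ 2.
Proof.
have := hkappa; rewrite ler_norml => /andP[_ h].
have : Ck * rD * delta ^+ 2 <= v s * delta ^+ 2.
  rewrite ler_pM2r ?exprn_gt0//; apply: le_trans (late_var tcs).
  by rewrite ler_wpM2r// ltW.
lra.
Qed.

Let sum_compl t : \sum_i (1 - gam t i) ^+ 2 = D%:R - 2 * (\sum_i gam t i) + v t.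
Proof.
have -> : D%:R = \sum_(i < D) 1 :> R by rewrite sumr_const card_ord.
by rewrite mulr_sumr -sumrB /v -big_split/=; apply: eq_bigr => i _; ring.
Qed.

Let v_le_n1 t : 0 <= t -> v t <= \sum_i gam t i.
Proof.
by move=> t0; apply: ler_sum => i _; rewrite expr2 ler_piMl ?gam_ge0 ?gam_le1.
Qed.

(** The deterministic part of the deficit is of the order of the weak variance. The random part
    [- noise] is bounded by an exponential through [1 + x <= expR x]; the resulting bound is
    nonnegative, which settles the positive part. *)
Let residual_deficit w : Num.max (kappa - residual2 gam (Y w) s) 0 <=
  delta ^+ 2 * ((1 + 2 * C) * v s + 4 * rD * expR (-1 * theta * noise s w)).
Proof.
have d2 : 0 < delta ^+ 2 by rewrite exprn_gt0.
have r0 : 0 <= 4 * rD * expR (-1 * theta * noise s w).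
  by rewrite !mulr_ge0 ?expR_ge0 ?(ltW rD0).
have cv : 0 <= (1 + 2 * C) * v s by rewrite mulr_ge0 ?(ltW vs0)//; have := C1; lra.
rewrite ge_max; apply/andP; split; last by rewrite mulr_ge0 ?addr_ge0// ltW.
rewrite (@residual2_noise _ _ delta lam mu (fun i => eps i w) g)//.
have wb0 : 0 <= wbias2 gam lam mu s.
  by rewrite wbias2_residual2; apply: sumr_ge0 => i _; rewrite mulr_ge0 ?sqr_ge0.
rewrite -/gam sum_compl.
have noise_le : - noise s w <= 4 * rD * expR (-1 * theta * noise s w).
  have := expR_ge1Dx (-1 * theta * noise s w) => h.
  have : 4 * rD * (1 + -1 * theta * noise s w) <=
      4 * rD * expR (-1 * theta * noise s w) by rewrite ler_pM2l// mulr_gt0.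
  have -> : 4 * rD * (1 + -1 * theta * noise s w) = 4 * rD - noise s w.
    by rewrite /theta; field; rewrite gt_eqF.
  by have := rD0; lra.
have : delta ^+ 2 * - noise s w <=
    delta ^+ 2 * (4 * rD * expR (-1 * theta * noise s w)) by rewrite ler_pM2l.
have : delta ^+ 2 * (2 * \sum_i gam s i) <= delta ^+ 2 * (2 * (C * v s)).
  by rewrite ler_pM2l// ler_pM2l.
have dv : 0 <= delta ^+ 2 * v s by rewrite mulr_ge0// ltW.
have := kappa_hi; rewrite -/(noise s w); lra.
Qed.

Let stop w := tau Co delta kappa gam (Y w).

Let stopP w : [/\ tc <= stop w, residual2 gam (Y w) (stop w) <= kappa &
  forall t, tc <= t -> t < stop w -> kappa < residual2 gam (Y w) t].
Proof.
rewrite /stop /tau -/tc; set S := [set t | _].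
have S0 : S !=set0.
  have [t tct ht] := residual2_below hR1 lam01 (Y w) tc kappa0; by exists t; split.
have [|//|_ h] := @inf_closed _ (fun t => \sum_i Y w i ^+ 2 * (1 + -1 * g t (lam i)) ^+ 2) S kappa _ S0.
- exact: (@sum_sqr_continuous _ _ _ _ hR1 lam01 (fun i => Y w i ^+ 2) 1 (-1)).
- move=> t [tct ht]; split; first exact: le_trans (ltW tc0) tct.
  by rewrite -residual2E.
split.
- by apply: lb_le_inf => // t [].
- by rewrite residual2E.
- move=> t tct tS; rewrite ltNge; apply/negP => hk.
  have lS : has_lbound S by exists tc => u [].
  by apply: (inf_lt_notin lS tS); split.
Qed.

(* The weak bias at [t] is at most [delta^2 v s], so stopping after [t] forces the noise
   to exceed its mean by about [v t]; the factor [expR (- (2 ^+ j / 16))] is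
   split in two for the later use of [2 eta y^2 <= eta^2 y^4 + 1]. *)
Let late_stop w t j : s <= t -> t < stop w -> (1 < j)%N -> v t = 2 ^+ j * v s ->
  1 <= expR (- (2 ^+ j / 16)) * (expR (- (2 ^+ j / 16)) * expR (1 * theta * noise t w)).
Proof.
move=> st tstop j1 vt; have [_ _ /(_ t)] := stopP w.
have t0 := le_trans (ltW s0) st.
have d2 : 0 < delta ^+ 2 by rewrite exprn_gt0.
move=> /(_ (le_trans tcs st) tstop).
rewrite (@residual2_noise _ _ delta lam mu (fun i => eps i w) g)// -/gam.
rewrite sum_compl -/(noise t w) => h.
have hn : v t - 2 * v s <= noise t w.
  rewrite -(ler_pM2l d2).
  have := kappa_lo; have := wbias_le st.
  have : delta ^+ 2 * v t <= delta ^+ 2 * \sum_i gam t i.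
    by rewrite ler_pM2l// v_le_n1.
  lra.
have j4 : 4 <= 2 ^+ j :> R.
  have -> : 4 = 2 ^+ 2 :> R by rewrite -natrX.
  by rewrite ler_weXn2l ?ler1n.
have hn2 : 2 ^+ j * rD / 2 <= noise t w.
  apply: le_trans hn; rewrite vt.
  have h1 : (2 ^+ j - 2) * rD <= (2 ^+ j - 2) * v s.
    by rewrite ler_wpM2l//; lra.
  have h2 : 4 * rD <= 2 ^+ j * rD by rewrite ler_wpM2r// ltW.
  lra.
rewrite -!expRD -[leLHS]expR0 ler_expR mul1r.
have : theta * (2 ^+ j * rD / 2) <= theta * noise t w by rewrite ler_pM2l.
have -> : theta * (2 ^+ j * rD / 2) = 2 ^+ j / 8.
  by rewrite /theta; field; rewrite gt_eqF.
lra.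
Qed.

(** Each [w] is assigned the first level [j] whose time [tl j] is not passed by [stop w]. The filter
    at [stop w] is dominated by the one at [tl j], and passing [tl j.-1] supplies a small factor.
    Summing nonnegative majorants over all levels avoids conditioning on the random level. *)
Let stochastic_bound : mean_le P
  (fun w => \sum_i gam (stop w) i ^+ 2 * lam i ^- 2 * eps i w ^+ 2)
  (2 * C * level_constant R Q * W).
Proof.
have /choice[tl htl] : forall j : nat, exists t,
    2 ^+ j * v s < D%:R -> s <= t /\ v t = 2 ^+ j * v s.
  move=> j; have [lt|//] := pselect (2 ^+ j * v s < D%:R); last by exists 0.
  have [|t st vt] := sum_sqr_level hR1 lam01 (ltW s0) _ lt.
    by rewrite ler_peMl ?(ltW vs0)// exprn_ege1// ler1n.
  by exists t.
pose top j := D%:R <= 2 ^+ j * v s.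
have exJ : exists j, top j.
  exists D; apply: (@le_trans _ _ (2 ^+ D)); last by rewrite ler_peMr// (le_trans rD1).
  by rewrite -natrX ler_nat ltnW// ltn_expl.
case: (ex_minnP exJ) => J topJ Jmin.
have ltD j : ~~ top j -> 2 ^+ j * v s < D%:R by rewrite -ltNge.
have tl_ge j : ~~ top j -> s <= tl j by move=> /ltD/htl[].
pose wt j i := if top j then lam i ^- 2 else gam (tl j) i ^+ 2 * lam i ^- 2.
have lV0 i : 0 <= lam i ^- 2 by rewrite invr_ge0 sqr_ge0.
have wt0 j i : 0 <= wt j i by rewrite /wt; case: ifP => // _; rewrite mulr_ge0 ?sqr_ge0.
have wt_sum j : \sum_i wt j i <= C * W * (2 ^+ j) ^+ Q.
  rewrite -mulrA; have C0 : 0 <= C by rewrite (le_trans ler01).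
  rewrite /wt; have [tj|tj] := boolP (top j).
    apply: le_trans W_total _; rewrite ler_wpM2l// ler_wpM2l//.
    rewrite lerXn2r ?nnegrE ?divr_ge0 ?(ltW vs0)//.
    by rewrite ler_pdivrMr.
  have [st vt] := htl j (ltD j tj).
  have := W_growth st; rewrite vt ler_peMl ?(ltW vs0)//; last first.
    by rewrite exprn_ege1// ler1n.
  by rewrite mulfK ?gt_eqF// => /(_ isT).
pose eta j : R := expR (- (2 ^+ j / 16)).
(* [late_stop] is used at level [j.-1] and requires [1 < j.-1], hence the threshold 3. The sum of a
   fourth power and an exponential replaces the product of [eps i w ^+ 2] with the dependent event
   of late stopping. *)
pose H j i w := if (j < 3)%N then eps i w ^+ 2 else
  eta j.-1 * (eps i w ^+ 4 + expR (1 * theta * noise (tl j.-1) w)).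
pose h j : R := if (j < 3)%N then 16 else 258 * eta j.-1.
have eta0 j : 0 <= eta j by exact: expR_ge0.
have H0 j i w : 0 <= H j i w.
  rewrite /H; case: ifP => _; first exact: sqr_ge0.
  by rewrite mulr_ge0// addr_ge0 ?expR_ge0// exprn_even_ge0.
have H_mean j i : (j <= J)%N -> mean_le P (H j i) (h j).
  move=> jJ; rewrite /H /h; have [j3|j3] := ltnP j 3; first exact: mean_le_sqr.
  have j0 : (0 < j)%N := leq_trans (isT : 0 < 3)%N j3.
  have nt : ~~ top j.-1.
    by apply/negP => /Jmin; rewrite leqNgt prednK// jJ.
  have h1 := mean_le_fourth ind_eps normal_eps i.
  have h2 := noise_exp (or_introl erefl) (tl_ge _ nt).
  apply: (mean_le_trans (mean_leZ (eta0 j.-1) (mean_leD h1 h2))) => //.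
  by rewrite mulrC ler_wpM2r//; lra.
apply: (@mean_le_trans _ _ _ P
  (fun w => \sum_(j < J.+1) \sum_i wt j i * H j i w)
  (\sum_(j < J.+1) \sum_i wt j i * h j)).
- apply: mean_le_sum => j _; apply: mean_le_sum => i _; apply: mean_leZ => //.
  by apply: H_mean; rewrite -ltnS.
- move=> w.
  have [tstop _ _] := stopP w; have stop0 := le_trans (ltW tc0) tstop.
  pose reached j := top j || (stop w <= tl j).
  have exj : exists j, reached j by exists J; rewrite /reached topJ.
  case: (ex_minnP exj) => j hj jmin.
  have jJ : (j < J.+1)%N by rewrite ltnS jmin// /reached topJ.
  rewrite (bigD1 (Ordinal jJ))//= ler_wpDr//.
    by apply: sumr_ge0 => k _; apply: sumr_ge0 => i _; rewrite mulr_ge0.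
  apply: ler_sum => i _.
  have wle : gam (stop w) i ^+ 2 * lam i ^- 2 <= wt j i.
    rewrite /wt; case: ifPn => tj.
      by rewrite ler_piMl// exprn_ile1 ?gam_ge0 ?gam_le1.
    rewrite ler_wpM2r// lerXn2r ?nnegrE ?gam_ge0//.
      by rewrite (le_trans (ltW s0))// tl_ge.
    apply: (filter_mono hR1 lam01 i stop0).
    by move: hj; rewrite /reached (negbTE tj).
  apply: (ler_pM (mulr_ge0 (sqr_ge0 _) (lV0 i)) (sqr_ge0 _) wle).
  rewrite /H; have [//|j3] := ltnP j 3.
  have j0 : (0 < j)%N := leq_trans (isT : 0 < 3)%N j3.
  have : ~~ reached j.-1 by apply/negP => /jmin; rewrite leqNgt prednK// leqnn.
  rewrite /reached negb_or => /andP[nt]; rewrite -ltNge => tlt.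
  have [st vt] := htl _ (ltD _ nt).
  have j1 : (1 < j.-1)%N by rewrite -ltnS prednK.
  have := late_stop st tlt j1 vt; rewrite -/(eta j.-1).
  set E := expR (1 * theta * _); set y := eps i w => hE.
  have e0 := eta0 j.-1; have E0 : 0 <= E by exact: expR_ge0.
  have e1 : 0 < eta j.-1 by exact: expR_gt0.
  (* [2 eta y^2 <= (eta y^2)^2 + 1] *)
  rewrite -(ler_pM2l e1).
  have y4 : y ^+ 4 = (y ^+ 2) ^+ 2 by rewrite -exprM.
  have := sqr_ge0 (eta j.-1 * y ^+ 2 - 1); rewrite y4; nra.
apply: (@le_trans _ _ (\sum_(j < J.+1) C * W * level_constant R Q * (2^-1) ^+ j)).
  apply: ler_sum => j _; rewrite -mulr_suml.
  apply: (@le_trans _ _ (C * W * (2 ^+ j) ^+ Q * h j)).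
    rewrite ler_wpM2r// /h; case: (j < 3)%N; first exact: ler0n.
    exact: mulr_ge0 (ler0n R 258) (eta0 _).
  rewrite -!mulrA (ler_wpM2l (le_trans ler01 C1))// ler_wpM2l// mulrC.
  exact: level_constantP.
rewrite -mulr_sumr.
have lc0 := level_constant_ge0 R Q.
have -> : 2 * C * level_constant R Q * W = C * W * level_constant R Q * 2 by ring.
by rewrite ler_wpM2l ?sum_half_le// !mulr_ge0// (le_trans ler01).
Qed.

(** After [s] the strong bias only decreases. Before [s] it is split into the bias at [s] and the
    weak bias at the stopping time, whose majorant has mean of order [delta ^+ 2 * v s]; [W_ge]
    converts this, times [m ^+ 2], into strong variance. *)
Let bias_bound : mean_le P (fun w => sbias2 gam mu (stop w))
  (4 * sbias2 gam mu s +
   bias_constant rho bp * (3 * (26 + 2 * C) * C * svar delta gam lam s)).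
Proof.
set Cb := bias_constant rho bp; have Cb0 : 0 <= Cb by exact: sqr_ge0.
have d20 : 0 <= delta ^+ 2 by exact: sqr_ge0.
have vs0' := ltW vs0; have rD0' := ltW rD0; have dl0 := ltW delta0.
have C0 : 0 <= C by exact: le_trans ler01 C1.
have m20 : 0 <= m ^+ 2 by exact: sqr_ge0.
have weak : mean_le P (fun w => 3 * (delta ^+ 2 * v s) +
    3 * (delta ^+ 2 * ((1 + 2 * C) * v s + 4 * rD * expR (-1 * theta * noise s w))) +
    3 * (delta ^+ 2 * \sum_i gam s i ^+ 2 * eps i w ^+ 2))
  (3 * (delta ^+ 2 * v s) +
    3 * (delta ^+ 2 * ((1 + 2 * C) * v s + 4 * rD * 2)) +
    3 * (delta ^+ 2 * \sum_i gam s i ^+ 2 * 16)).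
  apply: mean_leD; first apply: mean_leD.
  - by apply: mean_le_cst; rewrite !mulr_ge0.
  - do 2 (apply: mean_leZ => //); apply: mean_leD.
      by apply: mean_le_cst; rewrite mulr_ge0// addr_ge0 ?mulr_ge0.
    apply: mean_leZ; first by rewrite mulr_ge0.
    by apply: noise_exp => //; right.
  - do 2 (apply: mean_leZ => //); apply: mean_le_sum => i _.
    by apply: mean_leZ; [exact: sqr_ge0|exact: mean_le_sqr].
have wb0 t : 0 <= wbias2 gam lam mu t.
  by rewrite wbias2_residual2; apply: sumr_ge0 => i _; rewrite mulr_ge0 ?sqr_ge0.
have sb0 t : 0 <= sbias2 gam mu t.
  by apply: sumr_ge0 => i _; rewrite mulr_ge0 ?sqr_ge0.
apply: (mean_le_trans (mean_leD (mean_le_cst P (mulr_ge0 (ler0n _ 4) (sb0 s)))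
  (mean_leZ (mulr_ge0 Cb0 m20) weak))) => [w|].
  have [tstop hstop _] := stopP w; have stop0 := le_trans (ltW tc0) tstop.
  have rest0 : 0 <= 3 * (delta ^+ 2 * v s) +
    3 * (delta ^+ 2 * ((1 + 2 * C) * v s + 4 * rD * expR (-1 * theta * noise s w))) +
    3 * (delta ^+ 2 * \sum_i gam s i ^+ 2 * eps i w ^+ 2).
    have h1 : 0 <= \sum_i gam s i ^+ 2 * eps i w ^+ 2.
      by apply: sumr_ge0 => i _; rewrite mulr_ge0 ?sqr_ge0.
    have h2 := expR_ge0 (-1 * theta * noise s w).
    have h3 : 0 <= (1 + 2 * C) * v s by rewrite mulr_ge0// addr_ge0// mulr_ge0.
    have h4 := mulr_ge0 (mulr_ge0 (ler0n R 4) rD0') h2.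
    apply: addr_ge0 (mulr_ge0 (ler0n R 3) (mulr_ge0 d20 h1)).
    apply: addr_ge0 (mulr_ge0 (ler0n R 3) (mulr_ge0 d20 vs0')) _.
    exact: mulr_ge0 (ler0n R 3) (mulr_ge0 d20 (addr_ge0 h3 h4)).
  have [ss|ss] := leP s (stop w).
    apply: (@le_trans _ _ (sbias2 gam mu s)).
      exact: (residual2_dec hR1 lam01 mu (ltW s0) ss).
    rewrite ler_wpDr//; first by rewrite mulr_ge0// mulr_ge0.
    by have := sb0 s; lra.
  apply: le_trans (sbias2_split mu rho0 bp0 hR1 lam01 lam_dec (late_filter tcs) stop0) _.
  rewrite lerD2l -[leRHS]mulrA ler_wpM2l// ler_wpM2l//.
  apply: le_trans (wbias2_stopped_le hR1 lam01 stop0 (ltW ss) hstop) _.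
  rewrite lerD2r; apply: lerD.
    by rewrite ler_pM2l// wbias_le.
  by rewrite ler_pM2l// residual_deficit.
rewrite lerD2l -[leLHS]mulrA ler_wpM2l//.
(* The factor is [1 + (1 + 2 * C) + 8 + 16]: weak bias, deterministic deficit, exponential moment
   (with [rD <= v s]), and second moments. *)
apply: (@le_trans _ _ (m ^+ 2 * (delta ^+ 2 * (3 * (26 + 2 * C) * v s)))).
  rewrite ler_wpM2l// -mulr_suml -/(v s).
  have : delta ^+ 2 * rD <= delta ^+ 2 * v s by rewrite ler_wpM2l.
  lra.
have -> : m ^+ 2 * (delta ^+ 2 * (3 * (26 + 2 * C) * v s)) =
  3 * (26 + 2 * C) * delta ^+ 2 * (m ^+ 2 * v s) by ring.
have -> : 3 * (26 + 2 * C) * C * svar delta gam lam s =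
  3 * (26 + 2 * C) * delta ^+ 2 * (C * W) by rewrite /svar -/W; ring.
by rewrite ler_wpM2l// !mulr_ge0// addr_ge0// mulr_ge0.
Qed.

Lemma oracle_inequality :
  mean_le P (fun w => sqnorm (fun i =>
      estimator gam lam (Y w) (tau Co delta kappa gam (Y w)) i - mu i))
    (oracle_constant rho bp C Q * (sbias2 gam mu s + svar delta gam lam s)).
Proof.
have d20 : 0 <= delta ^+ 2 by exact: sqr_ge0.
have two0 : 0 <= 2 :> R by [].
apply: (mean_le_trans (mean_leD (mean_leZ two0 bias_bound)
  (mean_leZ two0 (mean_leZ d20 stochastic_bound)))) => [w|].
  exact: (@sqnorm_error_le _ _ delta lam mu (fun i => eps i w) g lam01).
have C0 : 0 <= C by exact: le_trans ler01 C1.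
have b0 : 0 <= sbias2 gam mu s.
  by apply: sumr_ge0 => i _; rewrite mulr_ge0 ?sqr_ge0.
have lc0 := level_constant_ge0 R Q.
have cb0 : 0 <= bias_constant rho bp by exact: sqr_ge0.
rewrite /oracle_constant /svar -/W.
set V := delta ^+ 2 * W; set B := sbias2 gam mu s in b0 *.
have V0 : 0 <= V by rewrite mulr_ge0.
set k1 := bias_constant rho bp in cb0 *; set k2 := level_constant R Q in lc0 *.
have h0 : 0 <= 26 + 2 * C by rewrite addr_ge0// mulr_ge0.
have h1 : 0 <= 6 * k1 * (26 + 2 * C) * C.
  exact: mulr_ge0 (mulr_ge0 (mulr_ge0 (ler0n R 6) cb0) h0) C0.
have h2 : 0 <= 4 * C * k2 by rewrite !mulr_ge0.
have -> : 2 * (4 * B + k1 * (3 * (26 + 2 * C) * C * V)) +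
    2 * (delta ^+ 2 * (2 * C * k2 * W)) =
  8 * B + (6 * k1 * (26 + 2 * C) * C + 4 * C * k2) * V by rewrite /V; ring.
by nra.
Qed.

End KeyInequality.

Lemma oracle_constant_ge0 (R : realType) (rho bp C : R) (Q : nat) :
  0 <= C -> 0 <= oracle_constant rho bp C Q.
Proof.
move=> C0; have lc0 := level_constant_ge0 R Q.
have h0 : 0 <= 26 + 2 * C by rewrite addr_ge0// mulr_ge0.
have h1 : 0 <= 6 * bias_constant rho bp * (26 + 2 * C) * C.
  exact: mulr_ge0 (mulr_ge0 (mulr_ge0 (ler0n R 6) (sqr_ge0 _)) h0) C0.
exact: addr_ge0 (addr_ge0 (ler0n R 8) h1) (mulr_ge0 (mulr_ge0 (ler0n R 4) C0) lc0).
Qed.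

(** * The times [t_circ], [t_weak] and [t_strong] *)

Section OracleTimes.
Context {R : realType} {D : nat}.
Variables (Co delta : R) (lam mu : 'I_D -> R) (g : R -> R -> R).
Hypotheses (D0 : (0 < D)%N) (Co1 : 1 <= Co) (CoD : Co < Num.sqrt D%:R).
Hypotheses (delta0 : 0 < delta) (hR1 : assumption_R1 g).
Hypothesis lam01 : forall i, 0 < lam i <= 1.
Let gam (t : R) (i : 'I_D) : R := g t (lam i).
Let tc := t_circ Co delta gam.

Let d2 : 0 < delta ^+ 2. Proof. by rewrite exprn_gt0. Qed.
Let rD0 : 0 < Num.sqrt D%:R :> R. Proof. by rewrite sqrtr_gt0 ltr0n. Qed.
Let level0 : 0 < Co * Num.sqrt D%:R * delta ^+ 2.
Proof. exact: mulr_gt0 (mulr_gt0 (lt_le_trans ltr01 Co1) rD0) d2. Qed.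

Let wvar0 : wvar delta gam 0 = 0.
Proof.
rewrite /wvar big1 ?mulr0// => i _; have [_ _ _ h] := hR1.
have [|_ g0 _] := h (lam i); first by case/andP: (lam01 i).
by rewrite /gam g0 expr0n.
Qed.

(** Negating the variance turns the lower bound at the infimum into an upper bound, the form treated
    by [inf_closed]. The level is attained because [Co < sqrt D] puts [Co * sqrt D] below the limit
    [D]. *)
Let t_circ_spec : 0 <= tc /\ Co * Num.sqrt D%:R * delta ^+ 2 <= wvar delta gam tc.
Proof.
rewrite /tc /t_circ; set S := [set t | _].
have S0 : S !=set0.
  have [||t t0 ht] := @sum_sqr_level _ _ g lam hR1 lam01 0 (Co * Num.sqrt D%:R) (lexx 0).
  - have := wvar0; rewrite /wvar => /eqP; rewrite mulf_eq0 gt_eqF//= => /eqP ->.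
    by rewrite mulr_ge0 ?(ltW rD0)// (le_trans ler01).
  - rewrite -[ltRHS]sqr_sqrtr ?ler0n// expr2 ltr_pM2r//.
  by exists t; split => //; rewrite /wvar ht mulrC.
have [|//|h1 h2] := @inf_closed _
  (fun t => \sum_i (- delta ^+ 2) * (0 + 1 * g t (lam i)) ^+ 2) S
  (- (Co * Num.sqrt D%:R * delta ^+ 2)) _ S0.
- exact: (@sum_sqr_continuous _ _ _ _ hR1 lam01 (fun=> - delta ^+ 2) 0 1).
- move=> t [t0 ht]; split => //; rewrite -ht wvarE -sumrN le_eqVlt; apply/orP; left.
  by apply/eqP; apply: eq_bigr => i _; rewrite mulNr.
split => //; rewrite wvarE -lerN2; apply: le_trans h2.
rewrite -sumrN le_eqVlt; apply/orP; left.
by apply/eqP; apply: eq_bigr => i _; rewrite mulNr.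
Qed.

Lemma t_circ_gt0 : 0 < tc.
Proof.
have [h0 h1] := t_circ_spec; rewrite lt_neqAle h0 andbT; apply/eqP => tc0.
by move: h1; rewrite -tc0 wvar0 leNgt level0.
Qed.

Lemma wvar_late t : tc <= t -> Co * Num.sqrt D%:R <= \sum_i gam t i ^+ 2.
Proof.
move=> tct; have [h0 h1] := t_circ_spec.
have := le_trans h1 (wvar_nondec hR1 lam01 delta h0 tct).
by rewrite /wvar [leRHS]mulrC ler_pM2r.
Qed.

(** Common form of both oracle times. The variance is nondecreasing and already positive at [tc],
    while the residual tends to 0, so they cross; continuity of the difference keeps the inequality
    at the infimum. *)
Let balance_spec (Y c : 'I_D -> R) : (forall i, 0 <= c i) ->
  0 < \sum_i c i * (0 + 1 * gam tc i) ^+ 2 ->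
  let t := inf [set t | tc <= t /\
    residual2 gam Y t <= \sum_i c i * (0 + 1 * gam t i) ^+ 2] in
  tc <= t /\ residual2 gam Y t <= \sum_i c i * (0 + 1 * gam t i) ^+ 2.
Proof.
move=> c0 V0 /=; set S := [set t | _]; have [tc0 _] := t_circ_spec.
have S0 : S !=set0.
  have [t tct ht] := residual2_below hR1 lam01 Y tc V0; exists t; split => //.
  apply: le_trans ht _; apply: ler_sum => i _; rewrite ler_wpM2l// !add0r !mul1r.
  have /andP[a0 _] := filter_bound hR1 lam01 i tc0.
  have /andP[b0 _] := filter_bound hR1 lam01 i (le_trans tc0 tct).
  by rewrite lerXn2r ?nnegrE//; exact: (filter_mono hR1 lam01 i tc0).
pose f1 t := \sum_i Y i ^+ 2 * (1 + -1 * g t (lam i)) ^+ 2.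
pose f2 t := \sum_i c i * (0 + 1 * g t (lam i)) ^+ 2.
have [|//|h0 h1] := @inf_closed _ (f1 - f2) S 0 _ S0.
- apply: within_continuousB.
    exact: (@sum_sqr_continuous _ _ _ _ hR1 lam01 (fun i => Y i ^+ 2) 1 (-1)).
  exact: (@sum_sqr_continuous _ _ _ _ hR1 lam01 c 0 1).
- move=> t [tct ht]; split; first exact: le_trans tct.
  by change (f1 t - f2 t <= 0); rewrite subr_le0 /f1 -residual2E.
split; first by apply: lb_le_inf => // t [].
by move: h1; change (f1 (inf S) - f2 (inf S) <= 0 ->
  residual2 gam Y (inf S) <= f2 (inf S)); rewrite subr_le0 /f1 -residual2E.
Qed.

Lemma t_weak_spec : let t := t_weak Co delta gam lam mu in
  tc <= t /\ wbias2 gam lam mu t <= wvar delta gam t.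
Proof.
rewrite /t_weak -/tc wbias2_residual2.
have -> : wvar delta gam = fun t => \sum_i (fun=> delta ^+ 2) i * (0 + 1 * gam t i) ^+ 2.
  by apply/funext => t; rewrite wvarE.
apply: balance_spec => [i|]; first exact: ltW.
by rewrite /= -wvarE; have [_] := t_circ_spec; exact: lt_le_trans.
Qed.

Lemma t_strong_spec : let t := t_strong Co delta gam lam mu in
  tc <= t /\ sbias2 gam mu t <= svar delta gam lam t.
Proof.
rewrite /t_strong -/tc sbias2_residual2.
have -> : svar delta gam lam =
    fun t => \sum_i (fun i => delta ^+ 2 * lam i ^- 2) i * (0 + 1 * gam t i) ^+ 2.
  by apply/funext => t; rewrite svarE.
apply: balance_spec => [i|]; first by rewrite mulr_ge0 ?ltW// invr_gt0 exprn_gt0; case/andP: (lam01 i).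
rewrite /= -svarE; have [_] := t_circ_spec; move=> h.
apply: lt_le_trans level0 (le_trans h _).
rewrite ler_pM2l//; apply: ler_sum => i _; rewrite ler_peMr ?sqr_ge0//.
have /andP[l0 l1] := lam01 i.
by rewrite invf_ge1 ?exprn_gt0// exprn_ile1// ltW.
Qed.

End OracleTimes.

(** * Lower bounds for the risks at deterministic times *)

Section LowerBounds.
Context {R : realType} {d : measure_display} {T : measurableType d}.
Context {P : probability T R} {D : nat}.
Variables (eps : 'I_D -> {RV P >-> R}) (delta : R) (lam mu : 'I_D -> R).
Variable gam : R -> 'I_D -> R.
Hypotheses (ind_eps : mutually_independent eps).
Hypotheses (normal_eps : forall i, standard_normal (eps i)).
Hypothesis lam01 : forall i, 0 < lam i <= 1.
Let Y (w : T) : 'I_D -> R := observation delta lam mu eps w.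

Lemma strong_risk_ge t :
  ((3^-1 * (sbias2 gam mu t + svar delta gam lam t))%:E <=
   'E_P[fun w => sqnorm (fun i => (estimator gam lam (Y w) t i - mu i)%R)])%E.
Proof.
have -> : (fun w => sqnorm (fun i => estimator gam lam (Y w) t i - mu i)) =
    fun w => \sum_i (- (1 - gam t i) * mu i + gam t i * delta / lam i * eps i w) ^+ 2.
  apply/funext => w; apply: eq_bigr => i _; congr (_ ^+ 2).
  by rewrite /estimator /Y /observation; field; rewrite gt_eqF//; case/andP: (lam01 i).
have -> : sbias2 gam mu t + svar delta gam lam t =
    \sum_i ((- (1 - gam t i) * mu i) ^+ 2 + (gam t i * delta / lam i) ^+ 2).
  rewrite /svar mulr_sumr -big_split/=; apply: eq_bigr => i _.
  by field; rewrite gt_eqF//; case/andP: (lam01 i).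
exact: expectation_ge_sqr.
Qed.

Lemma weak_risk_ge t :
  ((3^-1 * (wbias2 gam lam mu t + wvar delta gam t))%:E <=
   'E_P[fun w => sqnormA lam (fun i => (estimator gam lam (Y w) t i - mu i)%R)])%E.
Proof.
have -> : (fun w => sqnormA lam (fun i => estimator gam lam (Y w) t i - mu i)) =
    fun w => \sum_i (- (1 - gam t i) * (lam i * mu i) + gam t i * delta * eps i w) ^+ 2.
  apply/funext => w; apply: eq_bigr => i _; rewrite -exprMn; congr (_ ^+ 2).
  by rewrite /estimator /Y /observation; field; rewrite gt_eqF//; case/andP: (lam01 i).
have -> : wbias2 gam lam mu t + wvar delta gam t =
    \sum_i ((- (1 - gam t i) * (lam i * mu i)) ^+ 2 + (gam t i * delta) ^+ 2).
  rewrite /wvar mulr_sumr -big_split/=; apply: eq_bigr => i _; ring.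
exact: expectation_ge_sqr.
Qed.

End LowerBounds.

Theorem theorem3p5 (R : realType) (rho bm bp nu_m nu_p Co Ckappa : R) (L : nat)
    (hrho0 : 0 < rho) (hbm : 0 < bm) (hbp : 0 < bp)
    (hL : (0 < L)%N) (hnu_m : 0 < nu_m) (hnu_p : 0 < nu_p)
    (hCo : 1 <= Co) (hCkappa : 0 <= Ckappa < Co)
    (hrho : Num.max nu_p (1 + nu_p / 2) < rho) :
  exists Cs Cw : R,
    forall (D : nat) (delta kappa : R) (lam : 'I_D -> R) (g : R -> R -> R)
      (d : measure_display) (T : measurableType d) (P : probability T R)
      (eps : 'I_D -> {RV P >-> R}),
    let gam := fun (t : R) (i : 'I_D) => g t (lam i) in
    (0 < D)%N ->
    0 < delta ->
    Co < Num.sqrt D%:R ->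
    (forall i, 0 < lam i <= 1) ->
    (forall i j : 'I_D, (i <= j)%N -> lam j <= lam i) ->
    mutually_independent eps ->
    (forall i, standard_normal (eps i)) ->
    assumption_R rho bm bp (t_circ Co delta gam) g ->
    assumption_S nu_m nu_p L lam ->
    0 < kappa ->
    `|kappa - D%:R * delta ^+ 2| <= Ckappa * Num.sqrt D%:R * delta ^+ 2 ->
    forall mu : 'I_D -> R,
    let Y := observation delta lam mu eps in
    let ts := t_strong Co delta gam lam mu in
    let tw := t_weak Co delta gam lam mu in
    let tauw := fun w => tau Co delta kappa gam (Y w) in
    let err := fun (t : R) w i => estimator gam lam (Y w) t i - mu i in
    (tw <= ts ->
       ('E_P[fun w => sqnorm (err (tauw w) w)]
        <= Cs%:E * 'E_P[fun w => sqnorm (err ts w)])%E) /\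
    (ts <= tw ->
       ('E_P[fun w => sqnorm (err (tauw w) w)]
        <= (Cw * Num.min tw (entry lam D)^-1 ^+ 2)%R%:E
           * 'E_P[fun w => sqnormA lam (err tw w)])%E).
Proof.
have [C [Q [C1 HC]]] := variance_estimates hrho0 hbm hbp hL hnu_m hnu_p hrho.
have C0 : 0 <= C by exact: le_trans ler01 C1.
pose K := oracle_constant rho bp C Q.
have K0 : 0 <= K by exact: oracle_constant_ge0.
(* The factor 3 undoes the 1/3 of the lower risk bounds. In the second constant 2 comes from strong
   bias below strong variance at [tw], and [C] from replacing strong variance by [m ^+ 2] times weak
   variance. *)
exists (3 * K), (6 * K * C).
move=> D delta kappa lam g d T P eps gam D0 delta0 CoD lam01 lam_dec ind_eps
  normal_eps [hR1 _ hR3] HS kappa0 hkappa mu Y ts tw tauw err.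
case/andP: hCkappa => _ /ltW CkCo.
have tc0 := t_circ_gt0 D0 hCo CoD delta0 hR1 lam01.
have late_var := wvar_late D0 hCo CoD delta0 hR1 lam01.
have [tw_ge tw_bal] := t_weak_spec mu D0 hCo CoD delta0 hR1 lam01.
have [ts_ge ts_bal] := t_strong_spec mu D0 hCo CoD delta0 hR1 lam01.
rewrite -/gam -/tw -/ts in tc0 late_var tw_ge tw_bal ts_ge ts_bal.
set tc := t_circ Co delta gam in tc0 late_var tw_ge ts_ge hR3.
have late_filter t : tc <= t -> filter_at rho bm bp lam t (g t).
  move=> tct; split; first exact: lt_le_trans tct.
    by move=> x x01; exact: hR3.
  apply: le_trans (late_var t tct); rewrite mulr_ege1//.
  by rewrite -[leLHS]sqrtr1 ler_wsqrtr// ler1n.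
have key s : tc <= s -> wbias2 gam lam mu s <= wvar delta gam s ->
    ('E_P[fun w => sqnorm (err (tauw w) w)] <=
     (K * (sbias2 gam mu s + svar delta gam lam s))%:E)%E.
  move=> tcs bal.
  have [n1_le _ W_ge W_total W_growth] :=
    HC D lam D0 lam01 lam_dec HS s (g s) (late_filter s tcs).
  apply: mean_leE => [w|]; first by apply: sumr_ge0 => i _; exact: sqr_ge0.
  apply: (@oracle_inequality _ _ _ _ _ eps delta kappa Co Ckappa rho bm bp C Q lam mu g s) => //.
  move=> t st vt; apply: W_growth => //.
  exact: late_filter (le_trans tcs st).
have mono_w t t' : tc <= t -> t <= t' -> wbias2 gam lam mu t' <= wbias2 gam lam mu t.
  move=> tct tt'; rewrite /gam wbias2_residual2.
  by apply: residual2_dec => //; exact: le_trans (ltW tc0) tct.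
split => [twts|tstw].
(* The weak bias decreases and the weak variance increases in time, so the balance at [tw] persists
   at the later time [ts]. *)
- have bal : wbias2 gam lam mu ts <= wvar delta gam ts.
    apply: le_trans (mono_w _ _ tw_ge twts) (le_trans tw_bal _).
    by apply: wvar_nondec => //; exact: le_trans (ltW tc0) tw_ge.
  apply: le_trans (key ts ts_ge bal) _.
  have -> : K * (sbias2 gam mu ts + svar delta gam lam ts) =
      3 * K * (3^-1 * (sbias2 gam mu ts + svar delta gam lam ts)) by field.
  rewrite EFinM; apply: lee_wpmul2l; first by rewrite lee_fin mulr_ge0.
  exact: strong_risk_ge.
- apply: le_trans (key tw tw_ge tw_bal) _.
  have [_ W_le _ _ _] := HC D lam D0 lam01 lam_dec HS tw (g tw) (late_filter tw tw_ge).
  set m := Num.min tw (entry lam D)^-1.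
  have ts0 : 0 <= ts by exact: le_trans (ltW tc0) ts_ge.
  (* The same persistence for the strong quantities, now from [ts] to the later time [tw]. *)
  have B_le : sbias2 gam mu tw <= svar delta gam lam tw.
    apply: (@le_trans _ _ (sbias2 gam mu ts)); first exact: residual2_dec.
    by apply: le_trans ts_bal _; exact: svar_nondec.
  have V_le : svar delta gam lam tw <= C * (m ^+ 2 * wvar delta gam tw).
    have -> : C * (m ^+ 2 * wvar delta gam tw) =
      delta ^+ 2 * (C * (m ^+ 2 * \sum_i gam tw i ^+ 2)) by rewrite /wvar; ring.
    by rewrite /svar ler_wpM2l ?sqr_ge0.
  have wb0 : 0 <= wbias2 gam lam mu tw.
    rewrite /gam wbias2_residual2; apply: sumr_ge0 => i _.
    by rewrite mulr_ge0 ?sqr_ge0.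
  apply: (@le_trans _ _ (6 * K * C * m ^+ 2 *
      (3^-1 * (wbias2 gam lam mu tw + wvar delta gam tw)))%:E); last first.
    rewrite EFinM; apply: lee_wpmul2l; last exact: weak_risk_ge.
    rewrite lee_fin.
    exact: mulr_ge0 (mulr_ge0 (mulr_ge0 (ler0n R 6) K0) C0) (sqr_ge0 m).
  rewrite lee_fin.
  apply: (@le_trans _ _ (K * (2 * (C * (m ^+ 2 * wvar delta gam tw))))).
    by rewrite ler_wpM2l//; lra.
  have -> : K * (2 * (C * (m ^+ 2 * wvar delta gam tw))) =
    2 * K * C * m ^+ 2 * wvar delta gam tw by ring.
  have -> : 6 * K * C * m ^+ 2 * (3^-1 * (wbias2 gam lam mu tw + wvar delta gam tw)) =
    2 * K * C * m ^+ 2 * (wbias2 gam lam mu tw + wvar delta gam tw) by field.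
  rewrite ler_wpM2l ?lerDr//.
  exact: mulr_ge0 (mulr_ge0 (mulr_ge0 (ler0n R 2) K0) C0) (sqr_ge0 m).
Qed.
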